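(* Consider any run of Algorithm A (the distributed Dykstra algorithm described in the context). Assume that the primal problem (P) is feasible (there is a point at which its objective is finite), that for all $n\ge 1$ we have $\bar{\mathcal E}_n=\big[\bigcup_{w=1}^{\bar w}S_{n,w}\big]\cap\bar{\mathcal E}$ and $\bigcup_{w=1}^{\bar w}S_{n,w}\supset\mathcal V$, and that Assumptions (A1), (A2), (A3) of the context hold. Then: (i) The sum $\sum_{n=1}^\infty\sum_{w=1}^{\bar w}\|\mathbf v_A^{n,w}-\mathbf v_A^{n,w-1}\|^2$ is finite and the sequence $\{F_{n,\bar w}(\{\mathbf z_\alpha^{n,\bar w}\}_{\alpha\in\bar{\mathcal E}\cup\mathcal V})\}_{n=1}^\infty$ is nondecreasing. (ii) There is a constant $C$ such that $\|\mathbf v_A^{n,w}\|^2\le C$ for all $n\in\mathbb N$ and $w\in\{1,\dots,\bar w\}$. (iii) For all $i\in\mathcal V_3\cup\mathcal V_4$, the vectors $\mathbf z_i^{n,w}$, $n\ge1$, $w\in\{1,\dots,\bar w\}$, are bounded. Suppose also that (1) there are constants $A$ and $B$ such that $\sum_{\alpha\in\bar{\mathcal E}\cup\mathcal V}\|\mathbf z_\alpha^{n,\bar w}\|\le A\sqrt n+B$ for all $n\ge 1$. Then: (iv) For all $\alpha\in[\bar{\mathcal E}\cup\mathcal V]\setminus\mathcal V_4$ we have $E_{\alpha,n}=0$ (for every $n$ for which $E_{\alpha,n}$ is defined), and for all $i\in\mathcal V_4$ we have $\lim_{n\to\infty}E_{i,n}=0$. (v) There exists a subsequence $\{\mathbf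 v_A^{n_k,\bar w}\}_{k=1}^\infty$ of $\{\mathbf v_A^{n,\bar w}\}_{n=1}^\infty$ which converges to some $\mathbf v_A^*\in[\mathbb R^m]^{|\mathcal V|}$ and is such that $$\lim_{k\to\infty}\langle \mathbf v_A^{n_k,\bar w}-\mathbf v_A^{n_k,p(n_k,\alpha)},\mathbf z_\alpha^{n_k,\bar w}\rangle=0\quad\text{for all }\alpha\in\bar{\mathcal E}\cup\mathcal V,$$ where the inner product is read as $0$ when $\alpha\in\bar{\mathcal E}\setminus\bar{\mathcal E}_{n_k}$ (in which case $\mathbf z_\alpha^{n_k,\bar w}=0$). (vi) Let $\mathbf f(\cdot)=\sum_{\alpha\in\bar{\mathcal E}\cup\mathcal V}\mathbf f_\alpha(\cdot)$. For the $\mathbf v_A^*$ in (v), $\bar{\mathbf x}-\mathbf v_A^*$ is the minimizer of (P), and for every $w\in\{1,\dots,\bar w\}$ $$\lim_{k\to\infty}F_{n_k,w}(\{\mathbf z_\alpha^{n_k,w}\}_{\alpha\in\bar{\mathcal E}\cup\mathcal V})=\lim_{k\to\infty}F(\{\mathbf z_\alpha^{n_k,w}\}_{\alpha\in\bar{\mathcal E}\cup\mathcal V})=\tfrac12\|\mathbf v_A^*\|^2+\mathbf f(\bar{\mathbf x}-\mathbf v_A^* ).$$ Consequently $\lim_{n\to\infty}\mathbf x^{n,\bar w}$ exists and equals $\bar{\mathbf x}-\mathbf v_A^*$, which is the minimizer of (P).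
   Context: **Problem.** $\mathcal G=(\mathcal V,\mathcal E)$ is a finite connected undirected graph and $\bar{\mathcal E}:=\mathcal E\times\{1,\dots,m\}$. For $\mathbf x\in[\mathbb R^m]^{|\mathcal V|}$, $\mathbf x_i=[\mathbf x]_i\in\mathbb R^m$ is the $i$-th block ($i\in\mathcal V$) and $[\mathbf x_i]_{\bar k}$ its $\bar k$-th coordinate; norms are Euclidean. For $i\in\mathcal V$, $f_i:\mathbb R^m\to\mathbb R\cup\{\infty\}$ is a (proper) closed convex function, and $\mathbf f_i(\mathbf x):=f_i(\mathbf x_i)$. The vertex set is a disjoint union $\mathcal V=\mathcal V_1\cup\mathcal V_2\cup\mathcal V_3\cup\mathcal V_4$: for $i\in\mathcal V_1$, $f_i$ is proximable; for $i\in\mathcal V_2$, $f_i$ is the indicator function of a closed convex set; for $i\in\mathcal V_3$, $f_i$ is proximable with $\mathrm{dom}(f_i)=\mathbb R^m$; for $i\in\mathcal V_4$, $f_i$ is subdifferentiable (a subgradient is easy to obtain) with $\mathrm{dom}(f_i)=\mathbb R^m$. (''Proximable'' is informal: $\arg\min_x f(x)+\frac12\|x-\bar x\|^2$ is easy to compute for any $\bar x$.) For $((i,j),\bar k)\in\bar{\mathcal E}$ let $H_{((i,j),\bar k)}:=\{\mathbf x:[\mathbf x_i]_{\bar k}=[\mathbf x_j]_{\bar k}\}$ and $\mathbf f_{((i,j),\bar k)}:=\delta_{H_{((i,j),\bar k)}}$ (indicator function). Fix $\bar{\mathbf x}\in[\mathbb R^m]^{|\mathcal V|}$. The primal problem is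 $$\text{(P)}\quad\min_{\mathbf x\in[\mathbb R^m]^{|\mathcal V|}}\tfrac12\|\mathbf x-\bar{\mathbf x}\|^2+\sum_{\alpha\in\bar{\mathcal E}\cup\mathcal V}\mathbf f_\alpha(\mathbf x),$$ with dual function (to be maximized; $^*$ denotes the Fenchel conjugate) $$F(\{\mathbf z_\alpha\}):=-\tfrac12\Big\|\bar{\mathbf x}-\sum_{\alpha\in\bar{\mathcal E}\cup\mathcal V}\mathbf z_\alpha\Big\|^2+\tfrac12\|\bar{\mathbf x}\|^2-\sum_{\alpha\in\bar{\mathcal E}\cup\mathcal V}\mathbf f_\alpha^*(\mathbf z_\alpha).$$ Let $F_{n,w}$ be defined by the same formula with $\mathbf f_\alpha^*$ replaced by $\mathbf f_{\alpha,n,w}^*$, where $\mathbf f_{\alpha,n,w}:=\mathbf f_\alpha$ for $\alpha\in[\bar{\mathcal E}\cup\mathcal V]\setminus\mathcal V_4$, and for $\alpha\in\mathcal V_4$ the functions $\mathbf f_{\alpha,n,w}\le\mathbf f_\alpha$ are generated by the algorithm; they have the form $\mathbf f_{i,n,w}(\mathbf x)=f_{i,n,w}(\mathbf x_i)$ with $f_{i,n,w}:\mathbb R^m\to\mathbb R$. **Connecting sets.** $D:=\{\mathbf x:\mathbf x_i=\mathbf x_j\ \forall i,j\in\mathcal V\}$, so $D^\perp=\{\mathbf z:\sum_{i\in\mathcal V}\mathbf z_i=0\}$. A set $\bar{\mathcal E}'\subset\bar{\mathcal E}$ *connects* $\mathcal V$ if $\bigcap_{(e,\bar k)\in\bar{\mathcal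 E}'}H_{(e,\bar k)}=D$ (equivalently, for each $\bar k$ the graph with vertices $\mathcal V$ and edges $\{e:(e,\bar k)\in\bar{\mathcal E}'\}$ is connected). $C_1>0$ is a fixed constant such that for every $\mathbf v\in D^\perp$ and every $\bar{\mathcal E}'$ connecting $\mathcal V$ there are $\mathbf z_\beta\in H_\beta^\perp$ ($\beta\in\bar{\mathcal E}'$) with $\sum_{\beta\in\bar{\mathcal E}'}\mathbf z_\beta=\mathbf v$ and $\|\mathbf z_\beta\|\le C_1\|\mathbf v\|$ (such a constant exists). **Derived quantities.** For all $(n,w)$: $\mathbf v_H^{n,w}=\sum_{\beta\in\bar{\mathcal E}}\mathbf z_\beta^{n,w}$, $\mathbf v_A^{n,w}=\mathbf v_H^{n,w}+\sum_{i\in\mathcal V}\mathbf z_i^{n,w}$, $\mathbf x^{n,w}=\bar{\mathbf x}-\mathbf v_A^{n,w}$. **Algorithm A.** Let $\bar w$ be a positive integer. Initialize: $\mathbf z_i^{1,0}$ ($i\in\mathcal V$) with $[\mathbf z_i^{1,0}]_j=0$ for $j\ne i$; $\mathbf v_H^{1,0}\in D^\perp$; for $i\in\mathcal V_4$, a function $\mathbf f_{i,1,0}(\mathbf x)=f_{i,1,0}(\mathbf x_i)$ with $f_{i,1,0}:\mathbb R^m\to\mathbb R$ convex and $f_{i,1,0}\le f_i$. For $n=1,2,\dots$: (a) Choose $\bar{\mathcal E}_n\subset\bar{\mathcal E}$ connecting $\mathcal V$, and choose $\{\mathbf z_\beta^{n,0}\}_{\beta\in\bar{\mathcal E}}$ with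 $\mathbf z_\beta^{n,0}=0$ for $\beta\notin\bar{\mathcal E}_n$, $\mathbf z_\beta^{n,0}\in H_\beta^\perp$ and $\|\mathbf z_\beta^{n,0}\|\le C_1\|\mathbf v_H^{n,0}\|$ for all $\beta\in\bar{\mathcal E}$, and $\sum_{\beta\in\bar{\mathcal E}}\mathbf z_\beta^{n,0}=\mathbf v_H^{n,0}$. (b) For $w=1,\dots,\bar w$: choose a nonempty $S_{n,w}\subset\bar{\mathcal E}_n\cup\mathcal V$. If $S_{n,w}\subset\mathcal V_4$, apply Subroutine B. Otherwise set $\mathbf f_{i,n,w}:=\mathbf f_{i,n,w-1}$ for all $i\in\mathcal V_4$ and let $\{\mathbf z_\alpha^{n,w}\}_{\alpha\in S_{n,w}}$ be a minimizer (assumed to exist) over $\{\mathbf z_\alpha\}_{\alpha\in S_{n,w}}$ of $$\tfrac12\Big\|\bar{\mathbf x}-\sum_{\alpha\notin S_{n,w}}\mathbf z_\alpha^{n,w-1}-\sum_{\alpha\in S_{n,w}}\mathbf z_\alpha\Big\|^2+\sum_{\alpha\in S_{n,w}}\mathbf f_{\alpha,n,w}^*(\mathbf z_\alpha).$$ In all cases set $\mathbf z_\alpha^{n,w}:=\mathbf z_\alpha^{n,w-1}$ for $\alpha\notin S_{n,w}$. (c) Set $\mathbf z_i^{n+1,0}:=\mathbf z_i^{n,\bar w}$ for $i\in\mathcal V$, $\mathbf v_H^{n+1,0}:=\mathbf v_H^{n,\bar w}$, and $\mathbf f_{i,n+1,0}:=\mathbf f_{i,n,\bar w}$ for $i\in\mathcal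 V_4$. **Subroutine B** (when $S_{n,w}\subset\mathcal V_4$). For each $i\in S_{n,w}$: let $y:=[\bar{\mathbf x}-\mathbf v_H^{n,w-1}-\mathbf z_i^{n,w-1}]_i$, pick $s\in\partial f_i(y)$ and set $\tilde f_{i,n,w-1}(x):=f_i(y)+\langle s,x-y\rangle$. Let $x_i^+$ and $z_i^+$ be the primal and dual solutions of $$\min_{x\in\mathbb R^m}\tfrac12\|[\bar{\mathbf x}-\mathbf v_H^{n,w-1}]_i-x\|^2+\max\{f_{i,n,w-1},\tilde f_{i,n,w-1}\}(x),$$ so $z_i^+=[\bar{\mathbf x}-\mathbf v_H^{n,w-1}]_i-x_i^+$. Define the affine function $$f_{i,n,w}(x):=\max\{f_{i,n,w-1},\tilde f_{i,n,w-1}\}(x_i^+)+\langle x-x_i^+,[\bar{\mathbf x}-\mathbf v_H^{n,w-1}]_i-x_i^+\rangle,$$ set $\mathbf f_{i,n,w}(\mathbf x):=f_{i,n,w}(\mathbf x_i)$, $[\mathbf z_i^{n,w}]_i:=z_i^+$ and $[\mathbf z_i^{n,w}]_j:=0$ for $j\ne i$. For $i\in\mathcal V_4\setminus S_{n,w}$ set $\mathbf f_{i,n,w}:=\mathbf f_{i,n,w-1}$. **Index $p$ and errors.** $p(n,\alpha):=\max\{w'\le\bar w:\alpha\in S_{n,w'}\}$, defined whenever $\alpha\in\bigcup_{w}S_{n,w}$. For such $\alpha$, $E_{\alpha,n}:=\mathbf f_\alpha(\bar{\mathbf x}-\mathbf v_A^{n,p(n,\alpha)})-\mathbf f_{\alpha,n,p(n,\alpha)}(\bar{\mathbf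 x}-\mathbf v_A^{n,p(n,\alpha)})\ge0$. **Assumptions.** (A1) Whenever $w>1$ and $S_{n,w}\subset\mathcal V_4$, for all $i\in S_{n,w}$ the vector $[\mathbf z_i^{n,w-1}]_i$ is the optimizer of $\min_{z\in\mathbb R^m}\frac12\|[\bar{\mathbf x}-\mathbf v_H^{n,w-1}]_i-z\|^2+f_{i,n,w-1}^*(z)$. (The paper rephrases this as: if $w_i\ge1$ is the largest $w'\le w-1$ with $i\in S_{n,w'}$, then for all $\tilde w\in\{w_i+1,\dots,w-1\}$, $(e,\bar k)\notin S_{n,\tilde w}$ whenever $i$ is an endpoint of $e$.) (A2) For all $n\ge1$, $i\in\mathcal V_4$ and $\tilde w\in\{p(n,i)+1,\dots,\bar w\}$ (with $p(n,i)$ defined), $(e,\bar k)\notin S_{n,\tilde w}$ whenever $i$ is an endpoint of $e$. (A3) $S_{n,1}=\mathcal V_4$ for all $n>1$. *)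

(* Defs.v *)
From HB Require Import structures.
From mathcomp Require Import all_boot all_order all_algebra.
From mathcomp Require Import all_classical all_reals all_analysis.

Set Implicit Arguments.
Unset Strict Implicit.
Unset Printing Implicit Defensive.

Import Order.TTheory GRing.Theory Num.Theory.
Import numFieldNormedType.Exports.

Local Open Scope classical_set_scope.
Local Open Scope ring_scope.

Section Convex_analysis.
Context {R : realType}.

Definition indicator {T : Type} (A : set T) (x : T) : \bar R :=
  if x \in A then 0%E else +oo%E.

Definition conjugate {T : Type} (ip : T -> T -> R) (h : T -> \bar R) (z : T)
  : \bar R :=
  ereal_sup [set ((ip x z)%:E - h x)%E | x in [set: T]].

Definition minimizer {T : Type} (h : T -> \bar R) (x : T) : Prop :=
  forall y, (h x <= h y)%E.

Definition orthogonal_to {T : Type} (ip : T -> T -> R) (A : set T) : set T :=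
  [set z | forall x, A x -> ip x z = 0].

Section Block.
Context {m : nat}.
Implicit Types (u v x y s : 'rV[R]_m) (f : 'rV[R]_m -> \bar R).

(* The library norm on matrices is the sup norm, hence the Euclidean one here
   and on products of blocks below. *)
Definition dot u v : R := \sum_(k < m) u 0 k * v 0 k.
Definition enorm u : R := Num.sqrt (dot u u).

Definition proper f := (forall x, f x != -oo%E) /\ exists x, (f x < +oo)%E.

Definition convex_efun f := forall x y (t : R), 0 <= t <= 1 ->
  (f (t *: x + (1 - t) *: y)%R <= t%:E * f x + (1 - t)%:E * f y)%E.

Definition proper_closed_convex f :=
  [/\ proper f, lower_semicontinuous f & convex_efun f].

Definition full_domain f := forall x, (f x < +oo)%E.

Definition subgradient f y s := forall x, (f y + (dot s (x - y))%:E <= f x)%E.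

End Block.

End Convex_analysis.

(* Data of the primal problem: edges are unordered pairs of vertices, and
   [vert1], ..., [vert4] are the four classes of vertices. *)
Record problem (R : realType) (V : finType) (m : nat) := Problem {
  edges : {set {set V}};
  vert1 : {set V};
  vert2 : {set V};
  vert3 : {set V};
  vert4 : {set V};
  fv : V -> 'rV[R]_m -> \bar R;
  xbar : {ffun V -> 'rV[R]_m}
}.

Section Primal_dual.
Context {R : realType} {V : finType} {m : nat}.
Variable P : problem R V m.

Local Notation X := {ffun V -> 'rV[R]_m}.

Definition bdot (x y : X) : R := \sum_i dot (x i) (y i).
Definition bnorm (x : X) : R := Num.sqrt (bdot x x).

Definition eidx := ({e : {set V} | e \in edges P} * 'I_m)%type.
Definition idx := (V + eidx)%type.

(* Being proximable, the requirement on [vert1] and half of the requirement on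
   [vert3], is a statement about computational cost without formal content. *)
Definition well_posed : Prop :=
  [/\ (forall e, e \in edges P -> #|e| = 2%N)
        /\ (forall i j, connect (fun a b => [set a; b]%SET \in edges P) i j),
      forall i, ((i \in vert1 P) + (i \in vert2 P) + (i \in vert3 P)
                 + (i \in vert4 P))%N = 1%N,
      forall i, proper_closed_convex (fv P i),
      forall i, i \in vert2 P -> exists C : set 'rV[R]_m,
        [/\ closed C, convex_set C & fv P i = indicator C]
    & (forall i, i \in vert3 P -> full_domain (fv P i))
        /\ (forall i, i \in vert4 P -> full_domain (fv P i)
              /\ forall y, exists s, subgradient (fv P i) y s)].

Definition Hset (b : eidx) : set X :=
  [set x : X | forall i j, i \in val b.1 -> j \in val b.1 ->
           x i 0 b.2 = x j 0 b.2].

Definition Dset : set X := [set x : X | forall i j, x i = x j].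

Definition fbold (a : idx) (x : X) : \bar R :=
  match a with
  | inl i => fv P i (x i)
  | inr b => indicator (Hset b) x
  end.

Definition fsum (x : X) : \bar R := (\sum_(a : idx) fbold a x)%E.

Definition primal (x : X) : \bar R :=
  ((2^-1 * bnorm (x - xbar P) ^+ 2)%:E + fsum x)%E.

Definition dual (fam : idx -> X -> \bar R) (z : idx -> X) : \bar R :=
  ((- (2^-1 * bnorm (xbar P - \sum_(a : idx) z a) ^+ 2)
    + 2^-1 * bnorm (xbar P) ^+ 2)%:E
   - \sum_(a : idx) conjugate bdot (fam a) (z a))%E.

Definition connects (Eb : {set eidx}) : Prop :=
  [set x : X | forall b, b \in Eb -> Hset b x] = Dset.

Definition connecting_constant (C : R) : Prop :=
  0 < C /\
  forall v, orthogonal_to bdot Dset v ->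
  forall Eb, connects Eb ->
  exists y : eidx -> X,
    [/\ forall b, b \in Eb -> orthogonal_to bdot (Hset b) (y b),
        \sum_(b in Eb) y b = v
      & forall b, b \in Eb -> bnorm (y b) <= C * bnorm v].

Definition idx4 : {set idx} := [set inl i | i in vert4 P]%SET.

(* Iterates of the algorithm. [zs n w a] is z_a^{n,w}; [gs n w i] is f_{i,n,w},
   only meaningful for i in [vert4 P]; [Ss n w] is S_{n,w} and [Es n] is the set
   of active edges of outer iteration n. Outer iterations start at n = 1. *)
Record trajectory := Trajectory {
  zs : nat -> nat -> idx -> X;
  gs : nat -> nat -> V -> 'rV[R]_m -> R;
  Ss : nat -> nat -> {set idx};
  Es : nat -> {set eidx}
}.

Section Run.
Variables (wbar : nat) (T : trajectory).

Definition vH (n w : nat) : X := \sum_(b : eidx) zs T n w (inr b).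
Definition vA (n w : nat) : X := vH n w + \sum_(i : V) zs T n w (inl i).
Definition xs (n w : nat) : X := xbar P - vA n w.

Definition fapprox (n w : nat) (a : idx) (x : X) : \bar R :=
  match a with
  | inl i => if i \in vert4 P then (gs T n w i (x i))%:E else fbold a x
  | inr _ => fbold a x
  end.

Definition Fval (n w : nat) : \bar R := dual fbold (zs T n w).
Definition Fapprox (n w : nat) : \bar R := dual (fapprox n w) (zs T n w).

Definition initialization : Prop :=
  [/\ forall i j, j != i -> zs T 1 0 (inl i) j = 0,
      orthogonal_to bdot Dset (vH 1 0)
    & forall i, i \in vert4 P ->
        convex_function [set: 'rV[R]_m] (gs T 1 0 i) /\
        forall x, ((gs T 1 0 i x)%:E <= fv P i x)%E].

(* That the z_b^{n,0} sum up to v_H^{n,0} is the definition of [vH n 0]; that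
   v_H^{n,0} is inherited from the previous outer iteration is in [transfer]. *)
Definition edge_choice (C : R) (n : nat) : Prop :=
  [/\ connects (Es T n),
      forall b, b \notin Es T n -> zs T n 0 (inr b) = 0,
      forall b, orthogonal_to bdot (Hset b) (zs T n 0 (inr b))
    & forall b, bnorm (zs T n 0 (inr b)) <= C * bnorm (vH n 0)].

Definition block_objective (n w : nat) (y : idx -> X) : \bar R :=
  ((2^-1 * bnorm (xbar P - \sum_(a | a \notin Ss T n w) zs T n w.-1 a
                  - \sum_(a in Ss T n w) y a) ^+ 2)%:E
   + \sum_(a in Ss T n w) conjugate bdot (fapprox n w a) (y a))%E.

Definition block_step (n w : nat) : Prop :=
  (forall i, i \in vert4 P -> gs T n w i = gs T n w.-1 i) /\
  minimizer (block_objective n w) (zs T n w).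

Definition cut_step_at (n w : nat) (i : V) : Prop :=
  let c := (xbar P - vH n w.-1) i in
  let y := (xbar P - vH n w.-1 - zs T n w.-1 (inl i)) i in
  exists s xp : 'rV[R]_m,
    let ftilde x := fine (fv P i y) + dot s (x - y) in
    let h x := Num.max (gs T n w.-1 i x) (ftilde x) in
    [/\ subgradient (fv P i) y s,
        minimizer (fun x => (2^-1 * enorm (c - x) ^+ 2 + h x)%:E) xp,
        forall x, gs T n w i x = h xp + dot (x - xp) (c - xp),
        zs T n w (inl i) i = c - xp
      & forall j, j != i -> zs T n w (inl i) j = 0].

Definition cut_step (n w : nat) : Prop :=
  (forall i, inl i \in Ss T n w -> cut_step_at n w i) /\
  (forall i, i \in vert4 P -> inl i \notin Ss T n w ->
     gs T n w i = gs T n w.-1 i).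

Definition inner_iteration (n w : nat) : Prop :=
  [/\ exists a, a \in Ss T n w,
      forall b, inr b \in Ss T n w -> b \in Es T n,
      if Ss T n w \subset idx4 then cut_step n w else block_step n w
    & forall a, a \notin Ss T n w -> zs T n w a = zs T n w.-1 a].

Definition transfer (n : nat) : Prop :=
  [/\ forall i, zs T n.+1 0 (inl i) = zs T n wbar (inl i),
      vH n.+1 0 = vH n wbar
    & forall i, i \in vert4 P -> gs T n.+1 0 i = gs T n wbar i].

Definition run (C : R) : Prop :=
  initialization /\
  forall n, (1 <= n)%N ->
    [/\ edge_choice C n,
        forall w, (1 <= w <= wbar)%N -> inner_iteration n w
      & transfer n].

Definition updated (n : nat) : {set idx} :=
  (\bigcup_(1 <= w < wbar.+1) Ss T n w)%SET.

(* Equal to 0 if a is not in [updated n], where p(n,a) is not defined. *)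
Definition plast (n : nat) (a : idx) : nat :=
  (\max_(1 <= w < wbar.+1 | a \in Ss T n w) w)%N.

Definition Eerr (a : idx) (n : nat) : \bar R :=
  (fbold a (xs n (plast n a))
   - fapprox n (plast n a) a (xs n (plast n a)))%E.

Definition pinner (a : idx) (n : nat) : R :=
  if a \in updated n
  then bdot (vA n wbar - vA n (plast n a)) (zs T n wbar a) else 0.

Definition full_coverage : Prop := forall n, (1 <= n)%N ->
  Es T n = [set b | inr b \in updated n]%SET /\
  forall i, inl i \in updated n.

Definition cut_optimality : Prop := forall n w, (1 <= n)%N ->
  (1 < w <= wbar)%N -> Ss T n w \subset idx4 ->
  forall i, inl i \in Ss T n w ->
  minimizer (fun z => (2^-1 * enorm ((xbar P - vH n w.-1) i - z) ^+ 2)%:E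
               + conjugate dot (fun x => (gs T n w.-1 i x)%:E) z)%E
            (zs T n w.-1 (inl i) i).

Definition no_late_edges : Prop := forall n i w, (1 <= n)%N ->
  i \in vert4 P -> (plast n (inl i) < w <= wbar)%N ->
  forall b : eidx, i \in val b.1 -> inr b \notin Ss T n w.

Definition starts_with_cuts : Prop :=
  forall n, (1 < n)%N -> Ss T n 1 = idx4.

Definition sqrt_growth : Prop := exists A B : R, forall n, (1 <= n)%N ->
  \sum_(a : idx) bnorm (zs T n wbar a) <= A * Num.sqrt n%:R + B.

End Run.

End Primal_dual.

(* Main.v *)
Require Import Defs.
From HB Require Import structures.
From mathcomp Require Import all_boot all_order all_algebra.
From mathcomp Require Import all_classical all_reals all_analysis.
From mathcomp Require Import ring lra.

(* Each block update is a proximal step, so at the point x produced by the step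
   the new dual block is a subgradient of the corresponding function (or of its
   affine model), and weak duality alone shows that the dual value increases by
   half the squared length of the move plus the Fenchel gaps of the old blocks
   at x.  The primal value at a feasible point bounds the dual values from above,
   whence (i) and (ii); (iii) holds because a convex function that is finite
   everywhere has bounded subgradients on bounded sets.

   At the start of outer iteration n + 1 all models of the nonsmooth terms are
   cut at the current point, so the model errors of iteration n are bounded by
   the increase of the dual value plus a multiple of the move, and tend to 0.

   The squared moves are summable, so by divergence of the harmonic series they
   are o(1/n) along a subsequence, along which the drift terms vanish against
   dual blocks of size O(sqrt n).  The optimality conditions at the last updates
   then express the dual value as the primal value at nearby points up to
   vanishing terms; lower semicontinuity and weak duality identify the limit as
   the minimizer, and the duality gap controls the distance to it for the whole
   sequence. *)

Set Implicit Arguments.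
Unset Strict Implicit.
Unset Printing Implicit Defensive.

Import Order.TTheory GRing.Theory Num.Theory.
Import numFieldNormedType.Exports.

Local Open Scope classical_set_scope.
Local Open Scope ring_scope.

(** * Euclidean norms *)

(** The affine models are not monotone: away from the new point a cut may fall below its
    predecessor. The dual increase survives because old and new model are compared only at the new
    primal point, where the affine model takes the value of the maximum it replaces.

    The starting dual blocks are arbitrary, so during outer iteration 1 a conjugate may be infinite.
    The dual value is known to be real at the end of that iteration, when every vertex has been
    updated, and at every later step. Hence the thresholds [2 <= n], and the finitely many iterates
    of iteration 1 are bounded separately.

    Redistributing the edge blocks at the start of an outer iteration is invisible to the dual
    value: the conjugate of an edge indicator vanishes on the orthogonal complement of [Hset b], and
    the sum of the blocks is kept.

    Different blocks satisfy their optimality conditions at different points, those of their last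
    updates. The inner products [pinner] are exactly the price of moving these conditions to the
    final point of the outer iteration.

    Conjugates are evaluated only through subgradients with an explicit real value, which keeps
    infinities out of the algebra. *)

Definition inner_product (R : realType) (T : lmodType R) (ip : T -> T -> R) :=
  [/\ forall x y, ip x y = ip y x,
      forall x y z, ip (x + y) z = ip x z + ip y z,
      forall a x y, ip (a *: x) y = a * ip x y
    & forall x, 0 <= ip x x /\ (ip x x = 0 -> x = 0)].

Section Inner_product.
Context {R : realType} {T : lmodType R} {ip : T -> T -> R}.
Hypothesis hip : inner_product ip.
Implicit Types x y z : T.

Lemma ipC x y : ip x y = ip y x. Proof. by case: hip. Qed.
Lemma ipDl x y z : ip (x + y) z = ip x z + ip y z. Proof. by case: hip. Qed.
Lemma ipZl a x y : ip (a *: x) y = a * ip x y. Proof. by case: hip. Qed.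
Lemma ip_ge0 x : 0 <= ip x x. Proof. by case: hip => _ _ _ /(_ x)[]. Qed.
Lemma ip_eq0 x : ip x x = 0 -> x = 0.
Proof. by case: hip => _ _ _ /(_ x)[]. Qed.
Lemma ipDr x y z : ip z (x + y) = ip z x + ip z y.
Proof. by rewrite ipC ipDl !(ipC z). Qed.
Lemma ipZr a x y : ip y (a *: x) = a * ip y x.
Proof. by rewrite ipC ipZl (ipC y). Qed.
Lemma ipNl x y : ip (- x) y = - ip x y.
Proof. by rewrite -scaleN1r ipZl mulN1r. Qed.
Lemma ipNr x y : ip y (- x) = - ip y x.
Proof. by rewrite ipC ipNl ipC. Qed.
Lemma ipBl x y z : ip (x - y) z = ip x z - ip y z.
Proof. by rewrite ipDl ipNl. Qed.
Lemma ipBr x y z : ip z (x - y) = ip z x - ip z y.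
Proof. by rewrite ipDr ipNr. Qed.
Lemma ip0l x : ip 0 x = 0.
Proof. by rewrite -(scale0r x) ipZl mul0r. Qed.
Lemma ip0r x : ip x 0 = 0. Proof. by rewrite ipC ip0l. Qed.
Lemma ip_sumr I (r : seq I) (Q : pred I) (F : I -> T) x :
  ip x (\sum_(i <- r | Q i) F i) = \sum_(i <- r | Q i) ip x (F i).
Proof. by apply: (big_morph (ip x)) => [y z|]; rewrite ?ipDr ?ip0r. Qed.

Definition ipE := (ipDl, ipDr, ipBl, ipBr, ipNl, ipNr, ipZl, ipZr).

Local Notation nrm x := (Num.sqrt (ip x x)).

Lemma ip_sqr x : nrm x ^+ 2 = ip x x.
Proof. by rewrite sqr_sqrtr ?ip_ge0. Qed.

Lemma ip_cauchy x y : `|ip x y| <= nrm x * nrm y.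
Proof.
have [x0|x0] := eqVneq (ip x x) 0.
  by rewrite (ip_eq0 x0) ip0l normr0 mulr_ge0 ?sqrtr_ge0.
have xp : 0 < ip x x by rewrite lt0r x0 ip_ge0.
rewrite -sqrtrM ?ip_ge0// -sqrtr_sqr ler_sqrt ?mulr_ge0 ?ip_ge0//.
have := ip_ge0 (ip x x *: y - ip x y *: x).
rewrite !ipE (ipC y x).
have -> : ip x x * (ip x x * ip y y) - ip x x * (ip x y * ip x y)
    - (ip x y * (ip x x * ip x y) - ip x y * (ip x y * ip x x))
    = ip x x * (ip x x * ip y y - ip x y ^+ 2) by ring.
by rewrite pmulr_rge0// subr_ge0.
Qed.

Lemma ip_le x y : ip x y <= nrm x * nrm y.
Proof. by rewrite (le_trans (ler_norm _)) ?ip_cauchy. Qed.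

Lemma ip_triangle x y : nrm (x + y) <= nrm x + nrm y.
Proof.
rewrite -(@ler_pXn2r _ 2) ?nnegrE ?addr_ge0 ?sqrtr_ge0//.
rewrite sqrrD !ip_sqr !ipE (ipC y x); have := ip_le x y; lra.
Qed.

Lemma ip_normN x : nrm (- x) = nrm x.
Proof. by rewrite !ipE opprK. Qed.

(** Expand the square, drop the nonnegative term in [d] and apply Cauchy-Schwarz. The loss is linear
    in the length of [d], which suits lower semicontinuity arguments. *)
Lemma ip_half_norm u d :
  2^-1 * nrm u ^+ 2 - nrm u * nrm d <= 2^-1 * nrm (u - d) ^+ 2.
Proof.
have := ip_le u d; have := ip_ge0 d.
rewrite !ip_sqr !ipE (ipC d u); lra.
Qed.

Lemma ip_normZ a x : nrm (a *: x) = `|a| * nrm x.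
Proof.
by rewrite !ipE mulrA sqrtrM -?expr2 ?sqr_ge0// sqrtr_sqr.
Qed.

End Inner_product.

Section Dot.
Context {R : realType} {m : nat}.
Implicit Types u v : 'rV[R]_m.

Lemma dot_inner_product : inner_product (@dot R m).
Proof.
split=> [u v|u v w|a u v|u].
- by apply: eq_bigr => k _; rewrite mulrC.
- by rewrite -big_split; apply: eq_bigr => k _; rewrite mxE mulrDl.
- by rewrite /dot mulr_sumr; apply: eq_bigr => k _; rewrite mxE mulrA.
split; first by apply: sumr_ge0 => k _; rewrite -expr2 sqr_ge0.
move/eqP; rewrite psumr_eq0 => [|k _]; last by rewrite -expr2 sqr_ge0.
move/allP => h; apply/rowP => k; rewrite mxE; apply/eqP.
by have := h k (mem_index_enum _); rewrite -expr2 sqrf_eq0.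
Qed.

Lemma coord_le_enorm u k : `|u 0 k| <= enorm u.
Proof.
rewrite -sqrtr_sqr /enorm ler_sqrt ?(ip_ge0 dot_inner_product)//.
rewrite /dot (bigD1 k)//= expr2 lerDl sumr_ge0// => j _.
by rewrite -expr2 sqr_ge0.
Qed.

Lemma enorm_le_coord u r : 0 <= r -> (forall k, `|u 0 k| <= r) ->
  enorm u <= Num.sqrt m%:R * r.
Proof.
move=> r0 h; rewrite -[r in leRHS]ger0_norm// -sqrtr_sqr -sqrtrM ?ler0n//.
rewrite ler_sqrt ?mulr_ge0 ?sqr_ge0 ?ler0n//.
have -> : m%:R * r ^+ 2 = \sum_(k < m) r ^+ 2.
  by rewrite sumr_const card_ord mulr_natl.
apply: ler_sum => k _.
by rewrite -expr2 -(real_normK (num_real _)) lerXn2r ?nnegrE.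
Qed.

End Dot.

Section Bdot.
Context {R : realType} {V : finType} {m : nat}.
Implicit Types x y : {ffun V -> 'rV[R]_m}.

Lemma bdot_inner_product : inner_product (@bdot R V m).
Proof.
have [dC dD dZ dP] := @dot_inner_product R m.
split=> [x y|x y z|a x y|x].
- by apply: eq_bigr => i _; rewrite dC.
- by rewrite -big_split; apply: eq_bigr => i _; rewrite ffunE dD.
- by rewrite /bdot mulr_sumr; apply: eq_bigr => i _; rewrite ffunE dZ.
split; first by apply: sumr_ge0 => i _; apply: (dP _).1.
move/eqP; rewrite psumr_eq0 => [|i _]; last exact: (dP _).1.
move/allP => h; apply/ffunP => i; rewrite ffunE; apply: (dP _).2.
exact/eqP/(h i (mem_index_enum _)).
Qed.

Lemma enorm_le_bnorm x i : enorm (x i) <= bnorm x.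
Proof.
rewrite /enorm /bnorm ler_sqrt ?(ip_ge0 bdot_inner_product)//.
rewrite /bdot (bigD1 i)//= lerDl sumr_ge0// => j _.
exact: (ip_ge0 dot_inner_product).
Qed.

End Bdot.

(** * Proximal points of convex functions *)

Lemma ereal_between (R : realType) (a b : \bar R) :
  (a < b)%E -> exists r : R, (a < r%:E)%E && (r%:E < b)%E.
Proof.
case: a b => [a||] [b||] //= ab.
- by exists ((a + b) / 2); rewrite !lte_fin; rewrite lte_fin in ab; lra.
- by exists (a + 1); rewrite lte_fin ltry; lra.
- by exists (b - 1); rewrite lte_fin ltNyr; lra.
- by exists 0; rewrite ltNyr ltry.
Qed.

Definition subgradient_at (R : realType) (T : lmodType R) (ip : T -> T -> R)
    (h : T -> \bar R) (p : T) (r : R) (z : T) :=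
  h p = r%:E /\ forall y, ((r + ip z (y - p))%:E <= h y)%E.

(** Surjectivity of the identity plus the subdifferential: [p] is the proximal point of [c],
    recorded by its optimality condition. In this form closedness and convexity enter the conjugate
    calculus. *)
Definition has_prox (R : realType) (T : lmodType R) (ip : T -> T -> R)
    (h : T -> \bar R) :=
  forall c, exists p r, subgradient_at ip h p r (c - p).

Section Proximal_map.
Context {R : realType} {m : nat}.
Implicit Types (x y c p : 'rV[R]_m) (f : 'rV[R]_m -> \bar R).

Let hip := @dot_inner_product R m.

Lemma lsc_cube f x (a : R) : lower_semicontinuous f -> (a%:E < f x)%E ->
  exists2 d : R, 0 < d & forall y, (forall k, `|y 0 k - x 0 k| < d) ->
    (a%:E < f y)%E.
Proof.
move=> lf /lf[U /nbhs_ballP[d/= d0 dU] Ua]; exists d => // y yd.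
apply/Ua/dU; split=> // i j; rewrite (ord1 i) /ball/= distrC; exact: yd.
Qed.

Lemma lsc_enorm f x (a : R) : lower_semicontinuous f -> (a%:E < f x)%E ->
  exists2 d : R, 0 < d & forall y, enorm (y - x) < d -> (a%:E < f y)%E.
Proof.
move=> lf /(lsc_cube lf)[d d0 h]; exists d => // y yd; apply: h => k.
by have := coord_le_enorm (y - x) k; rewrite !mxE => /le_lt_trans; apply.
Qed.

Lemma cube_compact (rho : R) :
  compact [set x : 'rV[R]_m | forall k, `|x 0 k| <= rho].
Proof.
have := @rV_compact R m (fun=> `[- rho, rho]%classic) (fun=> @segment_compact _ _ _).
congr (compact _); apply/seteqP; split => x /= h k; have := h k;
  by rewrite in_itv/= ler_norml.
Qed.

Lemma lsc_cube_min f (rho : R) : 0 <= rho -> lower_semicontinuous f ->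
  exists2 x : 'rV[R]_m, (forall k, `|x 0 k| <= rho) &
    forall y, (forall k, `|y 0 k| <= rho) -> (f x <= f y)%E.
Proof.
move=> rho0 lf; pose K := [set x : 'rV[R]_m | forall k, `|x 0 k| <= rho].
pose I := ereal_inf (f @` K).
have K0 : K 0 by move=> k; rewrite mxE normr0.
(* If the infimum is infinite, no level lies strictly above it and the filter base below would be
   empty. *)
have [Iy|In] := eqVneq I +oo%E.
  exists 0 => // y yK.
  have : (I <= f y)%E by apply: ereal_inf_lbound; exists y.
  by rewrite Iy; apply: le_trans; apply: leey.
have Ilt : (I < +oo)%E by rewrite ltey.
(* The strict sublevel sets above the infimum generate a proper filter on a compact cube. A cluster
   point attains the infimum: otherwise semicontinuity gives a neighbourhood missing some sublevel
   set. *)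
pose F := filter_from [set b : \bar R | (I < b)%E]
            (fun b => K `&` [set x | (f x < b)%E]).
have FF : ProperFilter F.
  apply: filter_from_proper.
    apply: filter_from_filter; first by exists +oo%E.
    move=> a b /= Ia Ib; exists (Order.min a b); first by rewrite lt_min Ia.
    by move=> x [Kx] /=; rewrite lt_min => /andP[].
  move=> b /= /ereal_inf_lt[_ [x Kx <-] xb]; by exists x.
have [|p [Kp clp]] := @cube_compact rho F FF.
  by exists +oo%E => //= x [].
exists p => // y yK; apply: (@le_trans _ _ I); last first.
  by apply: ereal_inf_lbound; exists y.
rewrite leNgt; apply/negP => /ereal_between[a /andP[Ia /lf[U nU Ua]]].
have [|x [[_ /= xa] /Ua]] := clp (K `&` [set x | (f x < a%:E)%E]) U _ nU.
  by exists a%:E.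
by move/(lt_trans xa); rewrite ltxx.
Qed.

Lemma lsc_add_quadratic f c : (forall x, f x != -oo%E) ->
  lower_semicontinuous f ->
  lower_semicontinuous (fun x => ((2^-1 * enorm (c - x) ^+ 2)%:E + f x)%E).
Proof.
move=> fN lf x a; set q := 2^-1 * enorm (c - x) ^+ 2 => ax.
have [b /andP[ab bf]] : exists b : R, ((a - q)%:E < b%:E)%E && (b%:E < f x)%E.
  by apply: ereal_between; rewrite EFinB lteBlDl.
rewrite lte_fin in ab.
have [U nU Ub] := lf _ _ bf.
(* The quadratic term drops by at most [enorm (c - x) * enorm (y - x)], and a sup-norm ball of
   radius [e] has Euclidean radius at most [Num.sqrt m%:R * e]. The product stays within the slack
   [b - (a - q)]; the summands 1 keep the denominator positive. *)
pose e := (b - (a - q)) / ((enorm (c - x) + 1) * (Num.sqrt m%:R + 1)).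
have n0 : 0 <= enorm (c - x) by apply: sqrtr_ge0.
have s0 : 0 <= Num.sqrt m%:R :> R by apply: sqrtr_ge0.
have e0 : 0 < e by rewrite divr_gt0 ?mulr_gt0//; lra.
exists (U `&` ball x e); first by apply: filterI => //; apply: nbhsx_ballx.
move=> y [/Ub by_ xy]; rewrite -lteBlDl// -EFinB.
apply: le_lt_trans by_; rewrite lee_fin.
have d : enorm (y - x) <= Num.sqrt m%:R * e.
  apply: enorm_le_coord; first exact: ltW.
  by move=> k; rewrite !mxE distrC; apply: ltW (xy.2 0 k).
have := ip_half_norm hip (c - x) (y - x).
rewrite opprB addrA subrK -/(enorm _) -/(enorm _) -/(enorm _) -/q.
have : enorm (c - x) * enorm (y - x) <= b - (a - q); last by lra.
apply: (le_trans (ler_wpM2l n0 d)).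
have -> : b - (a - q) = (enorm (c - x) + 1) * ((Num.sqrt m%:R + 1) * e).
  by rewrite /e; field; rewrite !lt0r_neq0//; lra.
apply: ler_pM => //; [by rewrite mulr_ge0// ltW|lra|].
by rewrite ler_wpM2r ?(ltW e0)//; lra.
Qed.

Lemma proper_finite f : Defs.proper f -> exists x (r : R), f x = r%:E.
Proof.
by move=> [fN [x]]; have := fN x; case e: (f x) => [r| |]// _ _; exists x, r.
Qed.

(* Convexity transports the bound on a cube around [x0] to a linear lower
   bound far away, along the ray from [x0]. *)
Lemma convex_minorant f : proper_closed_convex f ->
  exists a b : R, 0 <= b /\ forall x, ((a - b * enorm x)%:E <= f x)%E.
Proof.
move=> [pf lf cf]; have [x0 [r0 fx0]] := proper_finite pf; case: pf => fN _.
have n0 : 0 <= enorm x0 by apply: sqrtr_ge0.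
have rho0 : 0 <= enorm x0 + 1 by lra.
have [xm xmK] := lsc_cube_min rho0 lf.
have x0K k : `|x0 0 k| <= enorm x0 + 1 by have := coord_le_enorm x0 k; lra.
move=> hm; have := hm _ x0K; rewrite fx0.
have := fN xm; case: (f xm) hm => // M hm _; rewrite lee_fin => Mr0.
have near x : enorm (x - x0) <= 1 -> (M%:E <= f x)%E.
  move=> d; apply: hm => k; have -> : x 0 k = x0 0 k + (x - x0) 0 k.
    by rewrite !mxE; ring.
  apply: le_trans (ler_normD _ _) _.
  have := coord_le_enorm x0 k; have := coord_le_enorm (x - x0) k; lra.
exists (r0 - (enorm x0 + 1) * (r0 - M)), (r0 - M); split; first by lra.
move=> x; have tri : enorm (x - x0) <= enorm x + enorm x0.
  by have := ip_triangle hip x (- x0); rewrite (ip_normN hip).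
set d := enorm (x - x0) in tri *.
suff : ((r0 - (d + 1) * (r0 - M))%:E <= f x)%E.
  apply: le_trans; rewrite lee_fin; nra.
have [d1|d1] := leP d 1.
  apply: le_trans (near _ d1); rewrite lee_fin.
  have d0 : 0 <= d by apply: sqrtr_ge0.
  nra.
have dp : 0 < d by lra.
have t01 : 0 <= d^-1 <= 1 by rewrite invr_ge0 (ltW dp) invf_le1 ?(ltW d1).
have := near (d^-1 *: x + (1 - d^-1) *: x0).
have -> : d^-1 *: x + (1 - d^-1) *: x0 - x0 = d^-1 *: (x - x0).
  by rewrite scalerBl scalerBr scale1r; apply/rowP => k; rewrite !mxE; ring.
rewrite [enorm _](ip_normZ hip) -/(enorm (x - x0)) -/d ger0_norm ?invr_ge0 ?(ltW dp)//.
rewrite mulVf ?gt_eqF// => /(_ (lexx _)) h.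
have := le_trans h (cf x x0 d^-1 t01); rewrite fx0.
have := fN x; case: (f x) => [r| |]// _; last by rewrite leey.
rewrite -!EFinM -EFinD !lee_fin => h1.
have h2 : d * M <= r + (d - 1) * r0.
  have -> : r + (d - 1) * r0 = d * (d^-1 * r + (1 - d^-1) * r0).
    by field; rewrite gt_eqF.
  by rewrite ler_pM2l.
nra.
Qed.

Lemma prox_optimality f c p (r : R) : convex_efun f ->
  (forall x, f x != -oo%E) -> f p = r%:E ->
  minimizer (fun x => ((2^-1 * enorm (c - x) ^+ 2)%:E + f x)%E) p ->
  subgradient_at dot f p r (c - p).
Proof.
move=> cf fN fp mp; split=> // y.
have := fN y; case fy: (f y) => [ry| |]// _; last by rewrite leey.
rewrite lee_fin leNgt; apply/negP => lt.
set d := y - p in lt; set u := c - p in lt.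
pose q := r + dot u d - ry; have q0 : 0 < q by rewrite subr_gt0.
have n0 := ip_ge0 hip d.
(* Moving from [p] towards [y] by [t] gains [t * q] to first order and costs half of
   [t ^+ 2 * dot d d]; this [t] is so small that the gain wins. *)
pose t := Num.min 1 (q / (dot d d + 1)).
have t0 : 0 < t by rewrite lt_min ltr01 divr_gt0//; lra.
have t1 : t <= 1 by rewrite ge_min lexx.
have td : t * (dot d d + 1) <= q.
  by rewrite -ler_pdivlMr ?ge_min ?lexx ?orbT//; lra.
have t01 : 0 <= t <= 1 by rewrite ltW.
have := cf y p t t01; rewrite fy fp -!EFinM -EFinD => ct.
have := le_trans (mp (t *: y + (1 - t) *: p)) (leeD2l _ ct).
rewrite fp -!EFinD lee_fin.
have -> : c - (t *: y + (1 - t) *: p) = u - t *: d.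
  by rewrite /u /d; apply/rowP => k; rewrite !mxE; ring.
rewrite -/u /enorm; clearbody u d.
rewrite !(ip_sqr hip) !(ipE hip).
rewrite (ipC hip d u).
move=> h.
have : t * q <= t * (2^-1 * (t * dot d d)) by rewrite /q; lra.
rewrite ler_pM2l//; nra.
Qed.

Lemma closed_convex_has_prox f : proper_closed_convex f -> has_prox dot f.
Proof.
move=> pf c; have [a [b [b0 hab]]] := convex_minorant pf.
case: pf => pf lf cf; have [x0 [r0 fx0]] := proper_finite pf.
case: pf => fN _.
pose phi x := ((2^-1 * enorm (c - x) ^+ 2)%:E + f x)%E.
pose L := 2^-1 * enorm (c - x0) ^+ 2 + r0.
(* Outside the cube of radius [rho] the quadratic growth beats the affine-in-norm minorant, and the
   objective exceeds its value [L] at [x0]. A minimizer on the cube is therefore global; the last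
   summand puts [x0] inside. *)
pose rho := 2 * (enorm c + b) + 1 + 2 * (`|L| + `|a|) + enorm x0.
have cn : 0 <= enorm c by apply: sqrtr_ge0.
have xn : 0 <= enorm x0 by apply: sqrtr_ge0.
have Ln := normr_ge0 L; have an := normr_ge0 a.
have rho0 : 0 <= rho by rewrite /rho; lra.
have [p pK hp] := lsc_cube_min rho0 (lsc_add_quadratic (c := c) fN lf).
have phix0 : phi x0 = L%:E by rewrite /phi fx0.
have min_p : minimizer phi p.
  move=> y; case: (pselect (forall k, `|y 0 k| <= rho)); first exact: hp.
  move=> /existsNP[k /negP]; rewrite -ltNge => yk.
  have x0K j : `|x0 0 j| <= rho.
    by have := coord_le_enorm x0 j; rewrite /rho; lra.
  apply: (le_trans (hp _ x0K)); rewrite -/(phi x0) phix0.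
  apply: le_trans (leeD2l _ (hab y)); rewrite -EFinD lee_fin.
  have sy : rho < enorm y by apply: lt_le_trans yk (coord_le_enorm _ _).
  have cy : dot c y <= enorm c * enorm y := ip_le hip c y.
  have c0 := ip_ge0 hip c.
  have yy : enorm y ^+ 2 = dot y y := ip_sqr hip y.
  rewrite (ip_sqr hip) !(ipBl hip, ipBr hip) (ipC hip y c) -yy.
  have La := ler_norm L; have aa := ler_norm (- a); rewrite normrN in aa.
  rewrite /rho in sy.
  set s := enorm y in sy yy cy *.
  suff : L - a <= 2^-1 * s ^+ 2 - enorm c * s - b * s by lra.
  have : 2^-1 * s <= s * (2^-1 * s - enorm c - b).
    by rewrite mulrC ler_wpM2l//; lra.
  rewrite expr2; lra.
have fp : (f p < +oo)%E.
  have := min_p x0; rewrite phix0 /phi.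
  by have := fN p; case: (f p) => //= r; rewrite ltry.
have [r fpr] : exists r, f p = r%:E.
  by have := fN p; case: (f p) fp => // r; exists r.
exists p, r; exact: prox_optimality.
Qed.

End Proximal_map.

(** * Real-valued convex functions: local bounds, semicontinuity, subgradients *)

Section Finite_convex_functions.
Context {R : realType} {m : nat}.
Implicit Types (x y p s : 'rV[R]_m) (g : 'rV[R]_m -> R).

Let hip := @dot_inner_product R m.

Definition convex_fun g := forall x y (t : R), 0 <= t <= 1 ->
  g (t *: x + (1 - t) *: y) <= t * g x + (1 - t) * g y.

Lemma convex_functionW g : convex_function [set: 'rV[R]_m] g -> convex_fun g.
Proof.
move=> cg x y t /andP[t0 t1].
have := cg (Itv01 t0 t1) x y (in_setT _) (in_setT _).
by rewrite convRE.
Qed.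

Lemma convex_fun_efun g : convex_fun g -> convex_efun (fun x => (g x)%:E).
Proof. by move=> cg x y t t01; rewrite -!EFinM -EFinD lee_fin cg. Qed.

Lemma convex_fun_full (f : 'rV[R]_m -> \bar R) :
  proper_closed_convex f -> full_domain f ->
  (forall x, f x = (fine (f x))%:E) /\ convex_fun (fun x => fine (f x)).
Proof.
move=> [[fN _] _ cf] fd.
have fE x : f x = (fine (f x))%:E.
  by have := fN x; have := fd x; case: (f x).
split=> // x y t t01; have := cf x y t t01.
by rewrite (fE x) (fE y) (fE (_ + _)) -!EFinM -EFinD lee_fin.
Qed.

(* Induction on the number of coordinates allowed to move: in each new one,
   [x] lies between two points of opposite faces. *)
Lemma convex_cube_ub g (rho : R) : convex_fun g -> 0 < rho ->
  exists M : R, forall x, (forall k, `|x 0 k| <= rho) -> g x <= M.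
Proof.
move=> cg rho0.
have step (k : nat) : (k <= m)%N -> forall p, exists M : R, forall x,
    (forall j : 'I_m, (j < k)%N -> `|x 0 j - p 0 j| <= rho) ->
    (forall j : 'I_m, (k <= j)%N -> x 0 j = p 0 j) -> g x <= M.
  elim: k => [_ p|k IH km p].
    by exists (g p) => x _ xp; have -> : x = p by apply/rowP => j; apply: xp.
  pose k0 := Ordinal km.
  have [M1 hM1] := IH (ltnW km) (p + rho *: delta_mx 0 k0).
  have [M2 hM2] := IH (ltnW km) (p - rho *: delta_mx 0 k0).
  exists (`|M1| + `|M2|) => x xk xp.
  have := xk k0 (ltnSn _); rewrite ler_norml; set t := _ - _ => /andP[t1 t2].
  pose l := (t + rho) / (2 * rho).
  have l01 : 0 <= l <= 1.
    by rewrite divr_ge0 ?ler_pdivrMr ?mulr_gt0//; lra.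
  pose xa := x + (rho - t) *: delta_mx 0 k0.
  pose xb := x + (- rho - t) *: delta_mx 0 k0.
  have xE : x = l *: xa + (1 - l) *: xb.
    apply/rowP => j; rewrite !mxE /l; field; lra.
  have other (r : R) (j : 'I_m) : j != k0 :> nat ->
      (r *: delta_mx 0 k0 : 'rV[R]_m) 0 j = 0.
    have [->|jk _] := eqVneq j k0; first by rewrite eqxx.
    by rewrite !mxE (negPf jk) andbF mulr0.
  have same (r : R) : (r *: delta_mx 0 k0 : 'rV[R]_m) 0 k0 = r.
    by rewrite !mxE !eqxx mulr1.
  have ga : g xa <= M1.
    apply: hM1 => j jk.
      rewrite mxE [(p + _) 0 j]mxE !other ?(ltn_eqF jk)//.
      by rewrite !addr0; apply/xk/ltnW.
    rewrite mxE [(p + _) 0 j]mxE; have [jk0|jk0] := eqVneq j k0.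
      by rewrite jk0 !same /t; ring.
    rewrite !other// ?addr0; apply: xp.
    by rewrite ltn_neqAle jk andbT eq_sym.
  have gb : g xb <= M2.
    apply: hM2 => j jk.
      rewrite mxE -scaleNr [(p + _) 0 j]mxE !other ?(ltn_eqF jk)//.
      by rewrite !addr0; apply/xk/ltnW.
    rewrite mxE -scaleNr [(p + _) 0 j]mxE; have [jk0|jk0] := eqVneq j k0.
      by rewrite jk0 !same /t; ring.
    rewrite !other// ?addr0; apply: xp.
    by rewrite ltn_neqAle jk andbT eq_sym.
  rewrite xE; apply: (le_trans (cg _ _ _ l01)).
  have := ler_norm M1; have := ler_norm M2; case/andP: l01 => l0 l1 hM2' hM1'.
  have := normr_ge0 M1; have := normr_ge0 M2 => M20 M10.
  have : 0 <= l * (`|M1| - g xa) by rewrite mulr_ge0//; lra.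
  have : 0 <= (1 - l) * (`|M2| - g xb) by rewrite mulr_ge0//; lra.
  have : 0 <= l * `|M2| by rewrite mulr_ge0.
  have : 0 <= (1 - l) * `|M1| by rewrite mulr_ge0//; lra.
  lra.
have [M hM] := step m (leqnn _) 0; exists M => x xk; apply: hM => j.
  by move=> _; rewrite mxE subr0; apply: xk.
by rewrite leqNgt ltn_ord.
Qed.

(** The upper bound is the one on a cube. The lower bound follows from it, since 0 is the midpoint
    of [x] and [- x]. *)
Lemma convex_ball_bound g (rho : R) : convex_fun g ->
  exists2 M : R, 0 <= M & forall x, enorm x <= rho -> `|g x| <= M.
Proof.
move=> cg; pose rho' := `|rho| + 1.
have rho'0 : 0 < rho' by rewrite /rho'; have := normr_ge0 rho; lra.
have [M hM] := convex_cube_ub cg rho'0.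
have hb x : enorm x <= rho -> g x <= M.
  move=> xr; apply: hM => k; have := coord_le_enorm x k.
  by rewrite /rho'; have := ler_norm rho; lra.
exists (`|M| + 2 * `|g 0|); first by rewrite addr_ge0 ?mulr_ge0.
move=> x xr; have gx := hb _ xr.
have := hb (- x); rewrite [enorm _](ip_normN hip) => /(_ xr) gnx.
have h2 : 0 <= (2^-1 : R) <= 1 by apply/andP; split; lra.
have := cg x (- x) _ h2.
have -> : 2^-1 *: x + (1 - 2^-1) *: - x = 0.
  by apply/rowP => k; rewrite !mxE; field.
have := ler_norm M; have := ler_norm (- M).
have := ler_norm (g 0); have := ler_norm (- g 0).
rewrite !normrN ler_norml; lra.
Qed.

(** Extend the segment from [y] through [x] to [z] at sup-distance at most 1 beyond [x]. There [g]
    is at most [M], and [x] lies between [y] and [z], so [g y] is at least [g x - s * (M - g x)]. *)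
Lemma convex_fun_lsc g : convex_fun g ->
  lower_semicontinuous (fun x => (g x)%:E).
Proof.
move=> cg x a; rewrite lte_fin => ax.
have nx : 0 <= enorm x by apply: sqrtr_ge0.
have [|M hM] := @convex_cube_ub g (enorm x + 1) cg; first by lra.
have gxM : g x <= M.
  by apply: hM => k; have := coord_le_enorm x k; lra.
pose s := Num.min 1 ((g x - a) / (M - g x + 1)).
have s0 : 0 < s by rewrite lt_min ltr01 divr_gt0//; lra.
have s1 : s <= 1 by rewrite ge_min lexx.
have sM : s * (M - g x + 1) <= g x - a.
  by rewrite -ler_pdivlMr ?ge_min ?lexx ?orbT//; lra.
exists (ball x s); first exact: nbhsx_ballx.
move=> y [_ xy]; rewrite lte_fin.
pose z := x + s^-1 *: (x - y).
have gz : g z <= M.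
  apply: hM => k; rewrite mxE; apply: (le_trans (ler_normD _ _)).
  have := coord_le_enorm x k.
  suff : `|(s^-1 *: (x - y)) 0 k| <= 1 by lra.
  rewrite !mxE normrM ger0_norm ?invr_ge0 ?(ltW s0)// mulrC ler_pdivrMr//.
  by rewrite mul1r; apply/ltW/(xy 0 k).
pose t := (1 + s)^-1.
have t01 : 0 <= t <= 1.
  by rewrite /t invr_ge0 invf_le1; lra.
have := cg y z t t01.
have -> : t *: y + (1 - t) *: z = x.
  by apply/rowP => k; rewrite !mxE /t; field; rewrite !gt_eqF//; lra.
move=> h; have : (1 + s) * g x <= g y + s * g z.
  have -> : g y + s * g z = (1 + s) * (t * g y + (1 - t) * g z).
    by rewrite /t; field; rewrite gt_eqF//; lra.
  by rewrite ler_pM2l//; lra.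
nra.
Qed.

Lemma convex_fun_pcc g : convex_fun g ->
  proper_closed_convex (fun x => (g x)%:E).
Proof.
move=> cg; split; [|exact: convex_fun_lsc|exact: convex_fun_efun].
by split=> //; exists 0; rewrite ltry.
Qed.

(** Test the subgradient inequality one unit along [s], still in the ball of radius [rho + 1]. One
    [M] serves every minorant [phi] of [g], hence all models of one vertex function at once. *)
Lemma subgradient_enorm_le g (rho : R) : convex_fun g ->
  exists M : R, [/\ 0 <= M, forall x, enorm x <= rho -> `|g x| <= M,
    forall (phi : 'rV[R]_m -> R) x s, enorm x <= rho ->
      (forall y, phi y <= g y) ->
      (forall y, phi x + dot s (y - x) <= phi y) -> enorm s <= M - phi x &
    forall x s, enorm x <= rho -> (forall y, g x + dot s (y - x) <= g y) ->
      enorm s <= M + M].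
Proof.
move=> cg; have [M M0 hM] := convex_ball_bound (rho + 1) cg.
have hM1 x : enorm x <= rho -> `|g x| <= M.
  by move=> xr; apply: hM; rewrite (le_trans xr)// lerDl.
suff main (phi : 'rV[R]_m -> R) x s : enorm x <= rho ->
    (forall y, phi y <= g y) ->
    (forall y, phi x + dot s (y - x) <= phi y) -> enorm s <= M - phi x.
  exists M; split=> // x s xr sub; have := main g x s xr (fun=> lexx _) sub.
  by have := hM1 x xr; rewrite ler_norml; lra.
move=> xr phig sub.
have [s0|s0] := eqVneq (enorm s) 0.
  rewrite s0 subr_ge0 (le_trans (phig x))// (le_trans (ler_norm _))// hM//.
  by rewrite (le_trans xr)// lerDl.
have sp : 0 < enorm s by rewrite lt0r s0 sqrtr_ge0.
pose u := (enorm s)^-1 *: s.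
have nu : enorm u = 1.
  by rewrite [LHS](ip_normZ hip) ger0_norm ?invr_ge0 ?(ltW sp)// mulVf.
have := sub (x + u); rewrite [x + u]addrC addrK.
have -> : dot s u = enorm s.
  by rewrite (ipZr hip) -(ip_sqr hip) -/(enorm s) expr2 mulrA mulVf ?mul1r.
have := phig (u + x).
have : g (u + x) <= M.
  rewrite (le_trans (ler_norm _))// hM//.
  by rewrite (le_trans (ip_triangle hip _ _))// -/(enorm u) nu addrC lerD2r.
lra.
Qed.

Lemma affine_subgradient_at (f : 'rV[R]_m -> \bar R) (r : R) s x :
  (forall y, f y = (r + dot y s)%:E) ->
  subgradient_at dot f x (r + dot x s) s.
Proof.
move=> fE; split=> // y; rewrite fE lee_fin (ipC hip s) (ipBl hip); lra.
Qed.

(** Test the inequality in the direction [t - s]. This freezes the dual block of a vertex whose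
    model is affine. *)
Lemma affine_subgradient (f : 'rV[R]_m -> \bar R) (r c : R) s x t :
  (forall y, f y = (r + dot y s)%:E) -> subgradient_at dot f x c t -> t = s.
Proof.
move=> fE [fx sub]; apply/eqP; rewrite -subr_eq0; apply/eqP/(ip_eq0 hip).
have := sub (x + (t - s)); have := fx; rewrite !fE => -[<-].
rewrite lee_fin [x + _]addrC addrK.
have -> : dot (t - s + x) s = dot x s + dot s (t - s).
  by rewrite (ipDl hip) (ipC hip (t - s)) addrC.
rewrite addrA lerD2l => h; apply/eqP; rewrite eq_le (ip_ge0 hip) andbT.
by rewrite (ipBl hip) subr_le0.
Qed.

End Finite_convex_functions.

Section Real_sequences.
Context {R : realType}.
Implicit Types u v : nat -> R.

Lemma nondecreasing_from1_cvg u (B : R) :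
  (forall n n', (1 <= n <= n')%N -> u n <= u n') ->
  (forall n, (1 <= n)%N -> u n <= B) -> exists l : R, u @ \oo --> l.
Proof.
move=> nd ub; have cv : cvgn (fun n => u n.+1).
  apply: nondecreasing_is_cvgn; first by move=> n n' nn'; apply: nd.
  by exists B => _ [n _ <-]; apply: ub.
by exists (limn (fun n => u n.+1)); rewrite -cvg_shiftS.
Qed.

Lemma cvg_increments u (l : R) : u @ \oo --> l ->
  (fun n => u n.+1 - u n) @ \oo --> (0 : R).
Proof.
move=> ul; rewrite -(subrr l); apply: cvgB => //.
by move: ul; rewrite -cvg_shiftS.
Qed.

End Real_sequences.
(** * Conjugates and weak duality *)

Section Conjugate.
Context {R : realType} {T : lmodType R} {ip : T -> T -> R}.
Hypothesis hip : inner_product ip.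
Implicit Types (h : T -> \bar R) (x p z c : T) (r : R).

Lemma conjugate_ub h x z : ((ip x z)%:E - h x <= conjugate ip h z)%E.
Proof. by apply: ereal_sup_ubound; exists x. Qed.

Lemma conjugate_le h z r : (forall x, ((ip x z - r)%:E <= h x)%E) ->
  (conjugate ip h z <= r%:E)%E.
Proof.
move=> hr; apply: ge_ereal_sup => _ [x _ <-]; have := hr x.
by case: (h x) => [s| |]//; [rewrite -EFinB !lee_fin; lra|rewrite leNye].
Qed.

Lemma conjugate_gtNy h x z : (h x < +oo)%E -> (-oo < conjugate ip h z)%E.
Proof.
move=> hx; apply: lt_le_trans (conjugate_ub h x z).
by case: (h x) hx => [s| |]//= _; rewrite ltNyr.
Qed.

Lemma le_conjugate h h' z : (forall x, (h x <= h' x)%E) ->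
  (conjugate ip h' z <= conjugate ip h z)%E.
Proof.
move=> hh; apply: ge_ereal_sup => _ [x _ <-].
by apply: le_trans (conjugate_ub h x z); apply: leeB.
Qed.

Lemma subgradient_conjugate h p r z : subgradient_at ip h p r z ->
  conjugate ip h z = (ip p z - r)%:E.
Proof.
move=> [hp hz]; apply/eqP; rewrite eq_le; apply/andP; split.
  apply: conjugate_le => x; apply: le_trans (hz x).
  by rewrite lee_fin ipBr// (ipC hip z x) (ipC hip z p); lra.
by have := conjugate_ub h p z; rewrite hp.
Qed.

Lemma subgradient_at_lty h p r z : subgradient_at ip h p r z -> (h p < +oo)%E.
Proof. by case=> -> _; rewrite ltry. Qed.

Lemma subgradient_neqNy h p r z x : subgradient_at ip h p r z -> h x != -oo%E.
Proof. by case=> _ /(_ x); case: (h x). Qed.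

Lemma has_prox_lty h : has_prox ip h -> exists x, (h x < +oo)%E.
Proof. by move=> /(_ 0)[p [r /subgradient_at_lty ?]]; exists p. Qed.

Lemma has_prox_neqNy h x : has_prox ip h -> h x != -oo%E.
Proof. by move=> /(_ 0)[p [r /subgradient_neqNy ?]]. Qed.

Lemma has_prox_conjugate h : has_prox ip h ->
  exists z r, conjugate ip h z = r%:E.
Proof.
by move=> /(_ 0)[p [r /subgradient_conjugate ?]]; exists (0 - p), (ip p (0 - p) - r).
Qed.

(* Moreau decomposition: [c] splits into the proximal point of [h] and the
   proximal point of its conjugate. *)
Lemma prox_dual h c z : has_prox ip h ->
  (forall z', ((2^-1 * Num.sqrt (ip (c - z) (c - z)) ^+ 2)%:E
                 + conjugate ip h z <=
               (2^-1 * Num.sqrt (ip (c - z') (c - z')) ^+ 2)%:E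
                 + conjugate ip h z')%E) ->
  exists r, subgradient_at ip h (c - z) r z.
Proof.
move=> /(_ c)[p [r sub]] hz; exists r.
suff -> : z = c - p by rewrite opprB addrC subrK.
apply/eqP; rewrite -subr_eq0; apply/eqP/(ip_eq0 hip).
apply/eqP; rewrite eq_le ip_ge0// andbT.
have [hp _] := sub.
have := conjugate_ub h p z; rewrite hp => /(leeD2l (2^-1 * Num.sqrt (ip (c - z) (c - z)) ^+ 2)%:E).
move=> /le_trans /(_ (hz (c - p))).
rewrite (subgradient_conjugate sub) -!EFinB -!EFinD lee_fin !(ip_sqr hip).
rewrite !(ipE hip) (ipC hip p c) (ipC hip z c) (ipC hip z p); lra.
Qed.

(** A joint minimizer is a minimizer in each block separately, and there the Moreau decomposition
    applies. The work lies in cancelling the conjugates of the other blocks, which must first be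
    shown finite. *)
Lemma block_optimality (I : finType) (S : {set I}) (fam : I -> T -> \bar R)
    (c : T) (z : I -> T) :
  (forall a, a \in S -> has_prox ip (fam a)) ->
  minimizer (fun y => ((2^-1 * Num.sqrt (ip (c - \sum_(a in S) y a)%R
                                       (c - \sum_(a in S) y a)%R) ^+ 2)%:E
                       + \sum_(a in S) conjugate ip (fam a) (y a))%E) z ->
  forall a, a \in S -> exists r,
    subgradient_at ip (fam a) (c - \sum_(b in S) z b) r (z a).
Proof.
move=> hprox hz.
(* A competitor with finite conjugates makes the minimal value less than +oo; as no conjugate is
   -oo, none can be +oo at [z]. *)
have [y0 hy0] : {y0 : I -> T & forall a, a \in S ->
    exists r, conjugate ip (fam a) (y0 a) = r%:E}.
  apply: (@choice _ _ (fun a y => a \in S ->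
    exists r, conjugate ip (fam a) y = r%:E)) => a.
  have [/hprox/has_prox_conjugate[y hy]|aS] := boolP (a \in S).
    by exists y.
  by exists 0.
have gtNy a y : a \in S -> (-oo < conjugate ip (fam a) y)%E.
  by move=> /hprox/has_prox_lty[x]; apply: conjugate_gtNy.
have fin a : a \in S -> conjugate ip (fam a) (z a) \is a fin_num.
  have := hz y0.
  have -> : (\sum_(a in S) conjugate ip (fam a) (y0 a))%E =
      (\sum_(a in S) fine (conjugate ip (fam a) (y0 a)))%:E.
    by rewrite -sumEFin; apply: eq_bigr => b /hy0[r ->].
  move=> /le_lt_trans /(_ (ltry _)) h aS.
  rewrite fin_numElt gtNy//= ltey; apply/eqP => e; move: h.
  move: (2^-1 * _)%R => q.
  rewrite (bigD1 a)//= e addye ?addey//.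
  apply/eqP => /esum_eqNyP[b [_ /andP[bS _] bN]].
  by have := gtNy b (z b) bS; rewrite bN.
move=> a aS.
pose K := (\sum_(b in S | b != a) fine (conjugate ip (fam b) (z b)))%R.
pose ca := c - \sum_(b in S | b != a) z b.
have -> : c - \sum_(b in S) z b = ca - z a.
  by rewrite (bigD1 a)//= opprD addrA addrAC.
apply: prox_dual; first exact: hprox.
move=> z'; have := hz (fun b => if b == a then z' else z b).
have -> : c - \sum_(b in S) z b = ca - z a.
  by rewrite (bigD1 a)//= opprD addrA addrAC.
have -> : c - \sum_(b in S) (if b == a then z' else z b) = ca - z'.
  rewrite (bigD1 a)//= eqxx opprD addrA addrAC; congr (_ - _ - _).
  by apply: eq_bigr => b /andP[_ /negPf ->].
rewrite (bigD1 a aS) [X in (_ <= _ + X)%E -> _](bigD1 a aS)/= eqxx.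
have -> : (\sum_(b in S | b != a)
    conjugate ip (fam b) (if b == a then z' else z b))%E = K%:E.
  rewrite -sumEFin; apply: eq_bigr => b /andP[bS /negPf ->].
  by rewrite fineK// fin.
have -> : (\sum_(b in S | b != a) conjugate ip (fam b) (z b))%E = K%:E.
  by rewrite -sumEFin; apply: eq_bigr => b /andP[bS _]; rewrite fineK// fin.
by rewrite !addeA leeD2rE.
Qed.

End Conjugate.

Section Block_functions.
Context {R : realType} {V : finType} {m : nat}.
Implicit Types (x y z u v c : {ffun V -> 'rV[R]_m}).

Let hip := @dot_inner_product R m.
Let hbip := @bdot_inner_product R V m.

Lemma bdot_supp u v i : (forall j, j != i -> u j = 0) ->
  bdot u v = dot (u i) (v i).
Proof.
move=> u0; rewrite /bdot (bigD1 i)//= big1 ?addr0// => j ji.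
by rewrite u0// (ip0l hip).
Qed.

Lemma has_prox_lift (f : 'rV[R]_m -> \bar R) (i : V) : has_prox dot f ->
  has_prox (@bdot R V m) (fun x => f (x i)).
Proof.
move=> hf c; have [p [r [fp hp]]] := hf (c i).
pose q : {ffun V -> 'rV[R]_m} := [ffun j => if j == i then p else c j].
exists q, r; split; first by rewrite ffunE eqxx.
move=> y; rewrite (@bdot_supp _ _ i).
  by rewrite !ffunE eqxx; apply: hp.
by move=> j /negPf ji; rewrite !ffunE ji subrr.
Qed.

(** Changing a block [j] other than [i] leaves the function unchanged, so the inequality in the
    direction [z j] forces that block of the subgradient to vanish. *)
Lemma subgradient_lift (f : 'rV[R]_m -> \bar R) (i : V) x r z :
  subgradient_at (@bdot R V m) (fun x => f (x i)) x r z <->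
  subgradient_at dot f (x i) r (z i) /\ (forall j, j != i -> z j = 0).
Proof.
split=> [[fx hz]|[[fx hz] z0]]; last first.
  by split=> // y; rewrite (bdot_supp _ z0) !ffunE; apply: hz.
have z0 j : j != i -> z j = 0.
  move=> ji; apply: (ip_eq0 hip); apply/eqP.
  rewrite eq_le (ip_ge0 hip) andbT.
  pose d : {ffun V -> 'rV[R]_m} := [ffun k => if k == j then z j else 0].
  have := hz (x + d); rewrite ffunE [d i]ffunE eq_sym (negPf ji) addr0 fx.
  rewrite [x + d]addrC addrK (ipC hbip) (@bdot_supp _ _ j).
    by rewrite ffunE eqxx lee_fin gerDl.
  by move=> k /negPf kj; rewrite ffunE kj.
split=> //; split=> // y.
pose q : {ffun V -> 'rV[R]_m} := [ffun j => if j == i then y else x j].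
by have := hz q; rewrite (bdot_supp _ z0) !ffunE eqxx.
Qed.

End Block_functions.

Section Edge_functions.
Context {R : realType} {V : finType} {m : nat} {P : problem R V m}.
Implicit Types (x y z u v c : {ffun V -> 'rV[R]_m}) (b : eidx P).

Let hip := @dot_inner_product R m.
Let hbip := @bdot_inner_product R V m.

Lemma HsetD b x y : Hset b x -> Hset b y -> Hset b (x + y).
Proof. by move=> hx hy i j ie je; rewrite !ffunE !mxE (hx i j)// (hy i j). Qed.

Lemma HsetN b x : Hset b x -> Hset b (- x).
Proof. by move=> hx i j ie je; rewrite !ffunE !mxE (hx i j). Qed.

Lemma Hset0 b : Hset b 0.
Proof. by move=> i j _ _; rewrite !ffunE. Qed.

Lemma dotZ_delta (a : R) (k : 'I_m) (v : 'rV[R]_m) :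
  dot (a *: delta_mx 0 k) v = a * v 0 k.
Proof.
rewrite (ipZl hip) /dot (bigD1 k)//= big1 ?addr0 ?mxE ?eqxx ?mul1r// => j jk.
by rewrite mxE (negPf jk) andbF mul0r.
Qed.

Lemma has_prox_edge b : has_prox (@bdot R V m) (indicator (Hset b)).
Proof.
move=> c; pose e := val b.1; pose k := b.2.
(* The projection onto [Hset b] replaces coordinate [k] on the edge by its average; the residual [d]
   sums to 0 there, hence is orthogonal to [Hset b]. *)
pose a := (\sum_(i in e) c i 0 k) / #|e|%:R.
pose d : {ffun V -> 'rV[R]_m} :=
  [ffun i => if i \in e then (c i 0 k - a) *: delta_mx 0 k else 0].
have cdE i : i \in e -> (c - d) i 0 k = a.
  by move=> ie; rewrite !ffunE ie !mxE !eqxx/=; ring.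
exists (c - d), 0; split.
  by rewrite /indicator ifT// inE => i j ie je; rewrite !cdE.
move=> y; rewrite subKr /indicator.
case: ifPn => [|_]; last by rewrite leey.
rewrite inE add0r lee_fin => yH.
have -> : bdot d (y - (c - d)) = \sum_(i in e) (c i 0 k - a) * (y i 0 k - a).
  rewrite /bdot [RHS]big_mkcond; apply: eq_bigr => i _.
  rewrite [d i]ffunE; case: ifP => ie; last by rewrite (ip0l hip).
  by rewrite dotZ_delta ffunE mxE; congr (_ * (_ + _)); rewrite ffunE mxE cdE.
have [e0|[i0 i0e]] := set_0Vmem e.
  by rewrite big1// => i; rewrite e0 inE.
rewrite (eq_bigr (fun i => (c i 0 k - a) * (y i0 0 k - a))); last first.
  by move=> i ie; rewrite (yH i i0).
rewrite -mulr_suml big_split/= sumr_const mulNrn -[a *+ _]mulr_natr /a.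
rewrite divfK ?subrr ?mul0r// pnatr_eq0 -lt0n; apply/card_gt0P.
by exists i0.
Qed.

Lemma subgradient_edge b x r z :
  subgradient_at (@bdot R V m) (indicator (Hset b)) x r z <->
  [/\ Hset b x, r = 0 & orthogonal_to (@bdot R V m) (Hset b) z].
Proof.
split=> [[]|[xH -> zH]]; last first.
  split; first by rewrite /indicator ifT// inE.
  move=> y; rewrite /indicator; case: ifPn; last by rewrite leey.
  by rewrite inE => yH; rewrite (ipBr hbip) !(ipC hbip z) !zH// subr0 addr0.
rewrite {1}/indicator; case: ifPn => //; rewrite inE => xH [<-] hz.
have le0 y : Hset b y -> bdot y z <= 0.
  move=> yH; have := hz (y + x).
  rewrite addrK add0r (ipC hbip) /indicator ifT ?lee_fin// inE.
  exact: HsetD.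
split=> // y yH; apply/eqP; rewrite eq_le le0//=.
by have := le0 _ (HsetN yH); rewrite (ipNl hbip) oppr_le0.
Qed.

Lemma conjugate_edge b z : orthogonal_to (@bdot R V m) (Hset b) z ->
  conjugate (@bdot R V m) (indicator (Hset b)) z = 0%:E.
Proof.
move=> zH; have /subgradient_edge := And3 (@Hset0 b) (erefl (0 : R)) zH.
by move=> /(subgradient_conjugate hbip) ->; rewrite (ip0l hbip) subr0.
Qed.

(** A vector supported at a vertex off the edge belongs to [Hset b]; test [z] against its own block
    there. *)
Lemma orthogonal_edge_supp b z j : orthogonal_to (@bdot R V m) (Hset b) z ->
  j \notin val b.1 -> z j = 0.
Proof.
move=> zH jb; apply: (ip_eq0 hip).
pose d : {ffun V -> 'rV[R]_m} := [ffun k => if k == j then z j else 0].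
have : bdot d z = 0.
  apply: zH => i i' ie ie'; rewrite !ffunE.
  by case: eqP ie ie' => [->|_]; [rewrite (negPf jb)|case: eqP => // ->;
    rewrite (negPf jb)].
rewrite (@bdot_supp _ _ _ _ _ j) => [|k /negPf kj]; rewrite ffunE ?eqxx//.
by rewrite kj.
Qed.

End Edge_functions.

Section Weak_duality.
Context {R : realType} {V : finType} {m : nat} {P : problem R V m}.
Implicit Types (x : {ffun V -> 'rV[R]_m}) (z : idx P -> {ffun V -> 'rV[R]_m}).

Let hbip := @bdot_inner_product R V m.

(** The only inequality is Fenchel-Young, block by block; the quadratic terms match exactly after
    completing the square. The retained square lets the duality gap control the distance to [x],
    which later yields boundedness and convergence of the whole sequence. *)
Lemma dual_le_primal (fam : idx P -> {ffun V -> 'rV[R]_m} -> \bar R) z x :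
  (forall a, fam a x != -oo%E) ->
  (dual fam z + (2^-1 * bnorm (xbar P - (\sum_a z a) - x)%R ^+ 2)%:E
   <= (2^-1 * bnorm (x - xbar P)%R ^+ 2)%:E + \sum_a fam a x)%E.
Proof.
move=> fN; have [/existsP[a /eqP fa]|/existsPn fy] :=
  boolP [exists a, fam a x == +oo%E].
  suff -> : (\sum_a fam a x)%E = +oo%E by rewrite addey// leey.
  rewrite (bigD1 a)//= fa addye//; apply/eqP => /esum_eqNyP[b [_ _ fb]].
  by have := fN b; rewrite fb.
have fE a : fam a x = (fine (fam a x))%:E.
  by have := fN a; have := fy a; case: (fam a x).
rewrite /dual.
have -> : (\sum_a fam a x)%E = (\sum_a fine (fam a x))%:E.
  by rewrite -sumEFin; apply: eq_bigr.
have : ((\sum_a (bdot x (z a) - fine (fam a x)))%:E <=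
    \sum_a conjugate (@bdot R V m) (fam a) (z a))%E.
  rewrite -sumEFin; apply: lee_sum => a _.
  by have := conjugate_ub (ip := @bdot R V m) (fam a) x (z a); rewrite fE.
rewrite big_split/= -(ip_sumr hbip) sumrN; set Q := (\sum_a conjugate _ _ _)%E.
set s := (\sum_a z a)%R; set S := (\sum_a fine _).
case: Q => [q| |]//; last by rewrite /= addNye leNye.
rewrite lee_fin -EFinB -!EFinD lee_fin /bnorm !(ip_sqr hbip) !(ipE hbip).
rewrite (ipC hbip x (xbar P)) (ipC hbip s) (ipC hbip s x); lra.
Qed.

End Weak_duality.

(** * Sequences *)

Section Subsequences.
Context {R : realType}.

Lemma extract_subsequence (Q : nat -> nat -> Prop) :
  (forall k N, exists n, (N <= n)%N /\ Q k n) ->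
  exists phi : nat -> nat, {homo phi : k l / (k < l)%N >-> (k < l)%N} /\
    forall k, Q k (phi k).
Proof.
move=> hQ.
have [f hf] : {f : nat * nat -> nat & forall p, (p.2 <= f p)%N /\ Q p.1 (f p)}.
  by apply: (@choice _ _ (fun p n => (p.2 <= n)%N /\ Q p.1 n)) => p; apply: hQ.
pose phi := fix phi k := if k is k'.+1 then f (k, (phi k').+1) else f (0, 0)%N.
exists phi; split; last by case=> [|k]; apply: (hf (_, _)).2.
by apply: homo_ltn; [exact: ltn_trans|move=> k; apply: (hf (k.+1, _)).1].
Qed.

Lemma homo_geq_id (phi : nat -> nat) :
  {homo phi : k l / (k < l)%N >-> (k < l)%N} -> forall k, (k <= phi k)%N.
Proof.
by move=> h; elim=> // k IH; apply: leq_ltn_trans IH _; apply: h.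
Qed.

Lemma cvg_homo (phi : nat -> nat) :
  {homo phi : k l / (k < l)%N >-> (k < l)%N} -> phi @ \oo --> \oo.
Proof.
move=> h A [N _ NA]; exists N => // k /= Nk; apply: NA.
exact: leq_trans Nk (homo_geq_id h k).
Qed.

Lemma cvg_sumr (I : finType) (F : I -> nat -> R) (l : I -> R) :
  (forall i, F i @ \oo --> l i) ->
  (fun n => \sum_i F i n) @ \oo --> \sum_i l i.
Proof.
by move=> h; apply: cvg_big => [|i _]; [exact: add_continuous|exact: h].
Qed.

(* Otherwise [a] would dominate a multiple of the harmonic series. *)
Lemma summable_small_often (a : nat -> R) (B : R) : (forall n, 0 <= a n) ->
  (forall N, \sum_(1 <= n < N) a n <= B) ->
  forall (e : R) (N : nat), 0 < e ->
    exists n, (N <= n)%N /\ ((1 <= n)%N /\ a n * n%:R <= e).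
Proof.
move=> a0 aB e N e0; apply: contrapT => /forallNP h.
have big n : (N <= n)%N -> (1 <= n)%N -> n%:R^-1 <= a n / e.
  move=> Nn n1; rewrite ler_pdivlMr// mulrC ler_pdivrMr ?ltr0n//.
  rewrite leNgt; apply/negP => lt; apply: (h n); split=> //; split=> //.
  exact: ltW.
have partial n : \sum_(0 <= k < n) (k.+1%:R)^-1 <=
    N%:R + (\sum_(1 <= k < n.+1) a k) / e :> R.
  elim: n => [|n IH]; first by rewrite !big_geq// mul0r addr0.
  have a1 : 0 <= a n.+1 / e by rewrite divr_ge0// ltW.
  rewrite big_nat_recr//= [\sum_(1 <= k < n.+2) _]big_nat_recr//= mulrDl addrA.
  have [nN|Nn] := ltnP n.+1 N; last by rewrite lerD// big.
  apply: (@le_trans _ _ N%:R); last first.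
    rewrite -addrA lerDl addr_ge0// divr_ge0 ?(ltW e0)// sumr_ge0//.
  rewrite -(big_nat_recr n 0 (fun k => (k.+1%:R)^-1))//=.
  apply: (@le_trans _ _ (\sum_(0 <= k < n.+1) 1)).
    by apply: ler_sum => k _; rewrite invf_le1 ?ler1n.
  by rewrite sumr_const_nat subn0 ler_nat ltnW.
apply: (@dvg_harmonic R); apply: nondecreasing_is_cvgn.
  apply/nondecreasing_seqP => n; rewrite /series/= big_nat_recr//= lerDl.
  by rewrite invr_ge0.
exists (N%:R + B / e) => _ [n _ <-]; rewrite /series/=.
apply: (le_trans (partial n)); rewrite lerD2l ler_wpM2r ?invr_ge0 ?(ltW e0)//.
Qed.

(** Semicontinuity only provides real numbers strictly below each value. The hypothesis also
    excludes infinite values, since the corresponding [t i] could then be raised until the sum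
    exceeds [L]. *)
Lemma lee_sum_of_lt (I : finType) (f : I -> \bar R) (L : R) :
  (forall i, f i != -oo%E) ->
  (forall t : I -> R, (forall i, ((t i)%:E < f i)%E) -> \sum_i t i <= L) ->
  (\sum_i f i <= L%:E)%E.
Proof.
move=> fN h.
have [/existsP[i0 /eqP fi0]|/existsPn fy] := boolP [exists i, f i == +oo%E].
  have [t ht] : {t : I -> R & forall i, ((t i)%:E < f i)%E}.
    apply: (@choice _ _ (fun i t => (t%:E < f i)%E)) => i.
    have := fN i; case: (f i) => [r| |]// _; last by exists 0; rewrite ltry.
    by exists (r - 1); rewrite lte_fin ltrBlDr ltrDl.
  pose c := \sum_(i | i != i0) t i.
  have := h (fun i => if i == i0 then L - c + 1 else t i).
  rewrite (bigD1 i0)//= eqxx.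
  under eq_bigr => i /negPf -> do [].
  rewrite -/c addrAC subrK gerDl ler10 => hL; suff : false by [].
  by apply: hL => i; case: eqP => [->|]//; rewrite fi0 ltry.
have fE i : f i = (fine (f i))%:E.
  by have := fN i; have := fy i; case: (f i).
under eq_bigr => i _ do rewrite fE.
rewrite sumEFin lee_fin; apply/ler_addgt0Pr => e e0.
pose d := e / (#|I|%:R + 1).
have d0 : 0 < d by rewrite divr_gt0// ltr_wpDl.
have := h (fun i => fine (f i) - d).
rewrite big_split/= sumr_const -lerBlDr => hL.
suff : e >= d *+ #|I|.
  move=> de; apply: le_trans (hL _) => [|i].
    by rewrite lerD2l mulNrn lerN2.
  by rewrite {2}fE lte_fin ltrBlDr ltrDl.
rewrite -mulr_natr /d mulrAC ler_pdivrMr ?ltr_wpDl// ler_wpM2l ?(ltW e0)//.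
by rewrite lerDl.
Qed.

Lemma bnorm_le_enorm (V : finType) (m : nat) (x : {ffun V -> 'rV[R]_m}) (r : R) :
  0 <= r -> (forall i, enorm (x i) <= r) -> bnorm x <= Num.sqrt #|V|%:R * r.
Proof.
move=> r0 h; rewrite -[r in leRHS]ger0_norm// -sqrtr_sqr -sqrtrM ?ler0n//.
rewrite ler_sqrt ?mulr_ge0 ?sqr_ge0 ?ler0n//.
have -> : #|V|%:R * r ^+ 2 = \sum_(i : V) r ^+ 2 by rewrite sumr_const mulr_natl.
apply: ler_sum => i _; rewrite -(ip_sqr dot_inner_product).
by rewrite lerXn2r ?nnegrE ?sqrtr_ge0//; apply: h.
Qed.

Lemma bounded_cluster (V : finType) (m : nat) (x : nat -> {ffun V -> 'rV[R]_m})
    (rho : R) : (forall n, bnorm (x n) <= rho) ->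
  exists l, forall (e : R) N, 0 < e -> exists n, (N <= n)%N /\ bnorm (x n - l) < e.
Proof.
move=> hx; pose I := (V * 'I_m)%type.
pose flat (y : {ffun V -> 'rV[R]_m}) : 'rV[R]_#|{: I}| :=
  \row_q y (enum_val q).1 0 (enum_val q).2.
pose F := (flat \o x) @ \oo.
have [|l [_ cl]] := @cube_compact R #|{: I}| rho F _.
  exists 0%N => // n _ q; rewrite mxE.
  by rewrite (le_trans (coord_le_enorm _ _))// (le_trans (enorm_le_bnorm _ _)).
pose L : {ffun V -> 'rV[R]_m} := [ffun i => \row_k l 0 (enum_rank (i, k))].
exists L => e N e0.
pose C := Num.sqrt #|V|%:R * Num.sqrt m%:R : R.
have C0 : 0 <= C by rewrite mulr_ge0 ?sqrtr_ge0.
pose d := e / (C + 1); have d0 : 0 < d by rewrite divr_gt0// ltr_wpDl.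
have [||_ [[n Nn <-] [_ ld]]] := cl [set flat (x n) | n in [set n | (N <= n)%N]] (ball l d).
- by exists N => // n /= Nn; exists n.
- exact: nbhsx_ballx.
exists n; split=> //; apply: (@le_lt_trans _ _ (C * d)).
  rewrite /C -mulrA; apply: bnorm_le_enorm => [|i].
    by rewrite mulr_ge0 ?sqrtr_ge0 ?(ltW d0).
  apply: enorm_le_coord => [|k]; first exact: ltW.
  have := ld 0 (enum_rank (i, k)); rewrite /ball /= !mxE enum_rankK distrC.
  by rewrite !ffunE !mxE => /ltW.
by rewrite /d mulrCA gtr_pMr// ltr_pdivrMr ?ltr_wpDl// mul1r ltrDl.
Qed.

End Subsequences.

(** * Iterates of the algorithm *)

(* Locked, so that values at different iterations are never compared by
   unfolding. *)
HB.lock Definition dual_value (R : realType) (V : finType) (m : nat)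
  (P : problem R V m) (T : trajectory P) (n w : nat) : R := fine (Fapprox T n w).

Section Run.
Context {R : realType} {V : finType} {m : nat} {P : problem R V m} {C1 : R}
  {wbar : nat} {T : trajectory P}.
Hypothesis hP : well_posed P.
Hypothesis hrun : run wbar T C1.

Let hip := @dot_inner_product R m.
Let hbip := @bdot_inner_product R V m.

Local Notation X := {ffun V -> 'rV[R]_m}.
Local Notation z := (zs T).
Local Notation g := (gs T).
Local Notation S := (Ss T).

Lemma run_edge n : (1 <= n)%N -> edge_choice T C1 n.
Proof. by move=> /hrun.2[]. Qed.

Lemma run_inner n w : (1 <= n)%N -> (1 <= w <= wbar)%N -> inner_iteration T n w.
Proof. by move=> /hrun.2[_ + _]; apply. Qed.

Lemma run_transfer n : (1 <= n)%N -> transfer wbar T n.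
Proof. by move=> /hrun.2[]. Qed.

Lemma run_ind (Q : nat -> nat -> Prop) : Q 1%N 0%N ->
  (forall n w, (1 <= n)%N -> (1 <= w <= wbar)%N -> Q n w.-1 -> Q n w) ->
  (forall n, (1 <= n)%N -> Q n wbar -> Q n.+1 0%N) ->
  forall n w, (1 <= n)%N -> (w <= wbar)%N -> Q n w.
Proof.
move=> Q0 Qw Qn.
have inner n : (1 <= n)%N -> Q n 0%N -> forall w, (w <= wbar)%N -> Q n w.
  move=> n1 Qn0; elim=> // w IH wb.
  by apply: (Qw) => //; apply: IH; apply: ltnW.
elim=> [//|[_|n IH] w _ wb]; first exact: inner.
by apply: inner => //; apply: Qn => //; apply: IH.
Qed.

Lemma mem_idx4 (i : V) : (inl i \in idx4 P) = (i \in vert4 P).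
Proof. by rewrite mem_imset// => x y []. Qed.

Lemma idx4P a : a \in idx4 P -> exists2 i, i \in vert4 P & a = inl i.
Proof. by move=> /imsetP[i iv ->]; exists i. Qed.

Lemma full_fv i : (i \in vert3 P) || (i \in vert4 P) ->
  (forall x, fv P i x = (fine (fv P i x))%:E) /\
  convex_fun (fun x => fine (fv P i x)).
Proof.
move=> iv; case: hP => _ _ hpcc _ [h3 h4].
apply: convex_fun_full; first exact: hpcc.
by case/orP: iv => [/h3|/h4[]].
Qed.

Lemma fv4 i : i \in vert4 P ->
  (forall x, fv P i x = (fine (fv P i x))%:E) /\
  convex_fun (fun x => fine (fv P i x)).
Proof. by move=> iv; apply: full_fv; rewrite iv orbT. Qed.

(* The aggregate affine function produced by a cut touches the maximum of the
   old model and of the new cut at the proximal point [xp]. *)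
Lemma cut_stepE n w i : i \in vert4 P -> cut_step_at T n w i ->
  convex_fun (g n w.-1 i) -> (forall x, ((g n w.-1 i x)%:E <= fv P i x)%E) ->
  exists (s xp : 'rV[R]_m) (hx : R),
    let c := (xbar P - vH T n w.-1) i in
    let y := (xbar P - vH T n w.-1 - z n w.-1 (inl i)) i in
    [/\ subgradient (fv P i) y s,
        z n w (inl i) i = c - xp /\ forall j, j != i -> z n w (inl i) j = 0,
        forall x, g n w i x = hx + dot (x - xp) (c - xp),
        g n w.-1 i xp <= hx /\ fine (fv P i y) + dot s (xp - y) <= hx
      & forall x, ((g n w i x)%:E <= fv P i x)%E].
Proof.
move=> iv [s [xp [sub hmin gE zE z0]]] cg gf; have [fE cf] := fv4 iv.
pose c := (xbar P - vH T n w.-1) i.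
pose y := (xbar P - vH T n w.-1 - z n w.-1 (inl i)) i.
pose ft x := fine (fv P i y) + dot s (x - y).
pose h x := Num.max (g n w.-1 i x) (ft x).
have ch : convex_fun h.
  move=> x x' t t01; rewrite /h ge_max; have /andP[t0 t1] := t01.
  have u0 : 0 <= 1 - t by lra.
  apply/andP; split.
    apply: (le_trans (cg _ _ _ t01)); apply: lerD;
      by apply: ler_wpM2l => //; rewrite le_max lexx.
  have -> : ft (t *: x + (1 - t) *: x') = t * ft x + (1 - t) * ft x'.
    have -> : ft (t *: x + (1 - t) *: x') =
      fine (fv P i y) + dot s (t *: (x - y) + (1 - t) *: (x' - y)).
      congr (_ + dot s _); apply/rowP => k; rewrite !mxE; ring.
    by rewrite (ipDr hip) !(ipZr hip) /ft; ring.
  apply: lerD; by apply: ler_wpM2l => //; rewrite le_max lexx orbT.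
have [_ opt] : subgradient_at dot (fun x => (h x)%:E) xp (h xp) (c - xp).
  apply: prox_optimality => //; exact: convex_fun_efun.
exists s, xp, (h xp); split=> //.
- by split; rewrite /h le_max lexx ?orbT.
- move=> x; rewrite gE; apply: (@le_trans _ _ (h x)%:E).
    by have := opt x; rewrite (ipC hip (c - xp)).
  rewrite /h /Num.max; case: ifP => _; last exact: gf.
  by have := sub x; rewrite (fE y).
Qed.

(** Convexity and minorization are carried together: a new cut is a minorant because the proximal
    step on the old model is characterized by a subgradient, which needs the old model convex. *)
Lemma model_inv n w : (1 <= n)%N -> (w <= wbar)%N -> forall i, i \in vert4 P ->
  convex_fun (g n w i) /\ forall x, ((g n w i x)%:E <= fv P i x)%E.
Proof.
move: n w; apply: run_ind.
- by case: hrun => -[_ _ h _] i /h[/convex_functionW].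
- move=> n w n1 wb IH i iv; have [cg gf] := IH _ iv.
  case: (run_inner n1 wb) => _ _ + _; case: ifP => _; last first.
    by move=> [/(_ i iv) -> _].
  move=> [hc hn]; have [/hc cut|/hn ->//] := boolP (inl i \in S n w).
  have [s [xp [hx [_ _ gE _ gf']]]] := cut_stepE iv cut cg gf.
  split=> // x y t t01; rewrite !gE.
  have -> : t *: x + (1 - t) *: y - xp = t *: (x - xp) + (1 - t) *: (y - xp).
    by apply/rowP => k; rewrite !mxE; ring.
  by rewrite (ipDl hip) !(ipZl hip); lra.
- move=> n n1 IH i iv; case: (run_transfer n1) => _ _ /(_ i iv) ->.
  exact: IH.
Qed.

Lemma fapprox_has_prox n w a : (1 <= n)%N -> (w <= wbar)%N ->
  has_prox (@bdot R V m) (fapprox T n w a).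
Proof.
move=> n1 wb; case: a => [i|b]; last exact: has_prox_edge.
rewrite /fapprox; have [iv|iv] := boolP (i \in vert4 P); last first.
  apply: (has_prox_lift (f := fv P i)); apply: closed_convex_has_prox.
  by case: hP.
apply: (has_prox_lift (f := fun x => (g n w i x)%:E)).
apply: closed_convex_has_prox; apply: convex_fun_pcc.
by have [] := model_inv n1 wb iv.
Qed.

Lemma fapprox_neqNy n w a x : (1 <= n)%N -> (w <= wbar)%N ->
  fapprox T n w a x != -oo%E.
Proof. by move=> n1 wb; apply: has_prox_neqNy; apply: fapprox_has_prox. Qed.

Lemma fbold_neqNy (a : idx P) x : fbold a x != -oo%E.
Proof.
case: a => [i|b]; last by rewrite /= /indicator; case: ifP.
by case: hP => _ _ /(_ i)[[+ _] _ _] _ _; apply.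
Qed.

Lemma fapprox_le n w a x : (1 <= n)%N -> (w <= wbar)%N ->
  (fapprox T n w a x <= fbold a x)%E.
Proof.
move=> n1 wb; case: a => [i|b] //=; case: ifP => // iv.
by have [] := model_inv n1 wb iv.
Qed.

Lemma fapprox_notin n w a : a \notin idx4 P -> fapprox T n w a = fbold a.
Proof.
by case: a => // i; rewrite mem_idx4 => /negPf iv; apply/funext => x /=; rewrite iv.
Qed.

Lemma sum_idx (F : idx P -> X) :
  \sum_a F a = \sum_b F (inr b) + \sum_i F (inl i).
Proof. by rewrite big_sumType addrC. Qed.

Lemma vAE n w : vA T n w = \sum_a z n w a.
Proof. by rewrite sum_idx. Qed.

Lemma xsE n w : (1 <= n)%N -> (1 <= w <= wbar)%N ->
  xs T n w = xbar P - \sum_(a | a \notin S n w) z n w.-1 a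
             - \sum_(a in S n w) z n w a.
Proof.
move=> n1 wb; case: (run_inner n1 wb) => _ _ _ hz.
rewrite /xs vAE (bigID (mem (S n w)))/= opprD addrA addrAC; congr (_ - _ - _).
exact: eq_bigr.
Qed.

(** Optimality of a single block at the current primal point; it is derived for the blocks updated
    at step [w]. *)
Definition kkt n w a :=
  exists r, subgradient_at (@bdot R V m) (fapprox T n w a) (xs T n w) r (z n w a).

Lemma kkt_block n w : (1 <= n)%N -> (1 <= w <= wbar)%N -> block_step T n w ->
  forall a, a \in S n w -> kkt n w a.
Proof.
move=> n1 wb [_ hmin] a aS; rewrite /kkt xsE//.
have /andP[_ wb'] := wb.
apply: (block_optimality hbip (fam := fapprox T n w)) aS => //.
by move=> b _; apply: fapprox_has_prox.
Qed.

Lemma kkt_vertex n w i : kkt n w (inl i) -> exists r,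
  subgradient_at dot
    (fun x => if i \in vert4 P then (g n w i x)%:E else fv P i x)
    (xs T n w i) r (z n w (inl i) i) /\ forall j, j != i -> z n w (inl i) j = 0.
Proof.
move=> [r hr]; exists r; apply/(@subgradient_lift R V m (fun x =>
  if i \in vert4 P then (g n w i x)%:E else fv P i x)); exact: hr.
Qed.

Lemma z_supp n w i j : (1 <= n)%N -> (w <= wbar)%N -> j != i ->
  z n w (inl i) j = 0.
Proof.
move=> n1 wb; move: n w n1 wb i j; apply: run_ind.
- by case: hrun => -[].
- move=> n w n1 wb IH i j ji.
  have [_ _ + hz] := run_inner n1 wb.
  have [iS|/hz -> _] := boolP (inl i \in S n w); last exact: IH.
  case: ifP => [/fintype.subsetP sub|_ hb].
    by move=> [/(_ i iS)[s [xp [_ _ _ _]]] + _]; apply.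
  by have [r [_ ->]] := kkt_vertex (kkt_block n1 wb hb iS).
- by move=> n n1 IH i j ji; have [-> _ _] := run_transfer n1; apply: IH.
Qed.

Lemma z_orth n w b : (1 <= n)%N -> (w <= wbar)%N ->
  orthogonal_to (@bdot R V m) (Hset b) (z n w (inr b)).
Proof.
move=> n1 wb; move: n w n1 wb b; apply: run_ind.
- by case: (@run_edge 1%N isT).
- move=> n w n1 wb IH b; have [_ _ + hz] := run_inner n1 wb.
  have [bS|/hz -> _] := boolP (inr b \in S n w); last exact: IH.
  case: ifP => [/fintype.subsetP/(_ _ bS)/idx4P[]//|_ hb].
  by have [r /subgradient_edge[]] := kkt_block n1 wb hb bS.
- by move=> n n1 _ b; case: (@run_edge n.+1 isT).
Qed.

(** Identifies the linearization point of a cut, written with [vH] and the dual block, as a block of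
    the primal iterate. *)
Lemma xs_coord n w i : (1 <= n)%N -> (w <= wbar)%N ->
  xs T n w i = (xbar P - vH T n w - z n w (inl i)) i.
Proof.
move=> n1 wb; rewrite /xs /vA opprD addrA [LHS]ffunE [RHS]ffunE.
congr (_ + _); rewrite !ffunE sum_ffunE (bigD1 i)//= big1 ?addr0// => j ji.
by rewrite z_supp// eq_sym.
Qed.

Lemma vH_cut n w : (1 <= n)%N -> (1 <= w <= wbar)%N -> S n w \subset idx4 P ->
  vH T n w = vH T n w.-1.
Proof.
move=> n1 wb /fintype.subsetP sub; have [_ _ _ hz] := run_inner n1 wb.
by apply: eq_bigr => b _; apply: hz; apply/negP => /sub/idx4P[].
Qed.

(** The cut step read in primal iterates: the linearization point is the old block, the proximal
    point is the new one because a cut step leaves [vH] unchanged, and [hx] is the new model's value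
    there. *)
Lemma cut_facts n w i : (1 <= n)%N -> (1 <= w <= wbar)%N ->
  S n w \subset idx4 P -> inl i \in S n w ->
  exists (s : 'rV[R]_m) (hx : R),
    let x := xs T n w i in let y := xs T n w.-1 i in
    [/\ subgradient (fv P i) y s,
        forall x', g n w i x' = hx + dot (x' - x) (z n w (inl i) i)
      & g n w.-1 i x <= hx /\ fine (fv P i y) + dot s (x - y) <= hx].
Proof.
move=> n1 wb sub iS; have [_ _ + hz] := run_inner n1 wb.
rewrite sub => -[/(_ i iS) cut _].
have [j jv [ij]] := idx4P (fintype.subsetP sub _ iS); rewrite -ij in jv.
have wb1 : (w.-1 <= wbar)%N by case/andP: wb => _; apply/leq_trans/leq_pred.
have wb2 : (w <= wbar)%N by case/andP: wb.
have [cg gf] := model_inv n1 wb1 jv.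
have [s [xp [hx [sg [zE _] gE [h1 h2] _]]]] := cut_stepE jv cut cg gf.
exists s, hx; have xpE : xs T n w i = xp.
  have e (u v : X) : (u - v) i = u i - v i by rewrite !ffunE.
  by rewrite xs_coord// vH_cut// e zE subKr.
rewrite xpE (xs_coord _ n1 wb1); split=> //.
by move=> x'; rewrite gE zE.
Qed.

(** Treats both kinds of steps uniformly. The second claim compares the models only at the new
    point: a block step keeps the model, and a cut takes there the value of a maximum involving the
    old one. *)
Lemma inner_kkt n w a : (1 <= n)%N -> (1 <= w <= wbar)%N -> a \in S n w ->
  kkt n w a /\
  (fapprox T n w.-1 a (xs T n w) <= fapprox T n w a (xs T n w))%E.
Proof.
move=> n1 wb aS; have [_ _ + _] := run_inner n1 wb; case: ifP; last first.
  move=> _ hb; split; first exact: kkt_block.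
  by case: a {aS} => [i|b]//=; case: ifP => // iv; case: hb => /(_ i iv) ->.
move=> sub _; have [i iv ai] := idx4P (fintype.subsetP sub _ aS); rewrite ai in aS *.
have [s [hx [_ gE [h1 _]]]] := cut_facts n1 wb sub aS.
have gx : g n w i (xs T n w i) = hx by rewrite gE subrr (ip0l hip) addr0.
have wb2 : (w <= wbar)%N by case/andP: wb.
split; last by rewrite /= iv lee_fin gx.
exists hx; apply/(@subgradient_lift R V m (fun x =>
  if i \in vert4 P then (g n w i x)%:E else fv P i x)).
split; last by move=> j; apply: z_supp.
rewrite iv; split; first by rewrite gx.
by move=> y; rewrite gE (ipC hip).
Qed.

Lemma updatedP n a :
  reflect (exists2 w, (1 <= w <= wbar)%N & a \in S n w) (a \in updated wbar T n).
Proof.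
rewrite /updated.
have -> : (a \in (\bigcup_(1 <= w < wbar.+1) S n w)%SET) =
    has (fun w => a \in S n w) (index_iota 1 wbar.+1).
  elim: (index_iota _ _) => [|w r IH]; first by rewrite big_nil inE.
  by rewrite big_cons inE IH.
apply: (iffP hasP) => [[w]|[w]]; rewrite ?mem_index_iota => wb aS;
  by exists w; rewrite ?mem_index_iota.
Qed.

Lemma plast_updated n a : a \in updated wbar T n ->
  (1 <= plast wbar T n a <= wbar)%N /\ a \in S n (plast wbar T n a).
Proof.
move=> /updatedP[w wb aS].
have wp : (w <= plast wbar T n a)%N.
  by apply: (leq_bigmax_seq (F := id)) => //; rewrite mem_index_iota.
have pb : (plast wbar T n a <= wbar)%N.
  by apply/bigmax_leqP_seq => i; rewrite mem_index_iota => /andP[].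
have p1 : (1 <= plast wbar T n a)%N by apply: leq_trans wp; case/andP: wb.
split; first by rewrite p1.
apply/negPn/negP => aN.
suff : (plast wbar T n a <= (plast wbar T n a).-1)%N.
  by rewrite leqNgt prednK ?leqnn.
apply/bigmax_leqP_seq => i ir iS; rewrite -ltnS prednK// ltn_neqAle.
rewrite (leq_bigmax_seq (F := id))// andbT.
by apply: contra aN => /eqP <-.
Qed.

Lemma plast_le n a : (plast wbar T n a <= wbar)%N.
Proof.
by apply/bigmax_leqP_seq => i; rewrite mem_index_iota => /andP[].
Qed.

Lemma after_plast n w a : (plast wbar T n a < w <= wbar)%N -> a \notin S n w.
Proof.
move=> /andP[pw wb]; apply/negP => aS.
have w1 : (1 <= w)%N by apply: leq_ltn_trans pw.
move: pw; rewrite ltnNge => /negP; apply.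
apply: (leq_bigmax_seq (F := id)) => //; by rewrite mem_index_iota ltnS w1.
Qed.

Lemma fapprox_notS n w a : (1 <= n)%N -> (1 <= w <= wbar)%N -> a \notin S n w ->
  fapprox T n w a = fapprox T n w.-1 a.
Proof.
move=> n1 wb aS; case: a aS => [i|b]//= aS; apply/funext => x /=.
case: ifPn => // iv; congr (_%:E); congr (_ _).
have [_ _ + _] := run_inner n1 wb; case: ifP => _ [h1 h2]; last exact: h1.
exact: h2.
Qed.

Lemma plast_stable n a w : (1 <= n)%N -> (plast wbar T n a <= w <= wbar)%N ->
  z n w a = z n (plast wbar T n a) a /\
  fapprox T n w a = fapprox T n (plast wbar T n a) a.
Proof.
move=> n1 /andP[]; elim: w => [|w IH pw wb].
  by rewrite leqn0 => /eqP ->.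
move: pw; rewrite leq_eqVlt => /orP[/eqP <-//|pw].
have aS : a \notin S n w.+1 by apply: after_plast; rewrite pw.
have [_ _ _ hz] := run_inner n1 (wb : (1 <= w.+1 <= wbar)%N).
by rewrite (hz _ aS) (fapprox_notS n1 _ aS)//; apply: IH => //; apply: ltnW.
Qed.

(** * Increase of the dual value *)

Definition dconj n w a := conjugate (@bdot R V m) (fapprox T n w a) (z n w a).

Lemma dconj_gtNy n w a : (1 <= n)%N -> (w <= wbar)%N -> (-oo < dconj n w a)%E.
Proof.
move=> n1 wb; have [x hx] := has_prox_lty (fapprox_has_prox a n1 wb).
exact: conjugate_gtNy hx.
Qed.

Lemma FapproxE n w : Fapprox T n w =
  ((- (2^-1 * bnorm (xs T n w) ^+ 2) + 2^-1 * bnorm (xbar P) ^+ 2)%:E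
   - \sum_a dconj n w a)%E.
Proof. by rewrite /Fapprox /dual /xs vAE. Qed.

Lemma dconj_fin n w : (1 <= n)%N -> (w <= wbar)%N -> (-oo < Fapprox T n w)%E ->
  forall a, dconj n w a \is a fin_num.
Proof.
move=> n1 wb Fy a; rewrite fin_numElt dconj_gtNy//= ltey; apply/eqP => e.
move: Fy; rewrite FapproxE (bigD1 a)//= e addye ?addeNy ?ltxx//.
apply/eqP => /esum_eqNyP[b [_ _ bN]].
by have := dconj_gtNy b n1 wb; rewrite bN.
Qed.

Lemma Fapprox_fin n w : (forall a, dconj n w a \is a fin_num) ->
  Fapprox T n w = (- (2^-1 * bnorm (xs T n w) ^+ 2) + 2^-1 * bnorm (xbar P) ^+ 2
    - \sum_a fine (dconj n w a))%:E.
Proof.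
move=> fin; rewrite FapproxE EFinB; congr (_ - _)%E.
by rewrite -sumEFin; apply: eq_bigr => a _; rewrite fineK.
Qed.

(** A Fenchel gap of the old dual block at the new primal point, with the conjugate of the old model
    but the value of the new one. *)
Definition gap n w a := fine (dconj n w.-1 a) - bdot (xs T n w) (z n w.-1 a)
  + fine (fapprox T n w a (xs T n w)).

Lemma gap_ge0 n w a : (1 <= n)%N -> (1 <= w <= wbar)%N -> a \in S n w ->
  dconj n w.-1 a \is a fin_num -> 0 <= gap n w a.
Proof.
move=> n1 wb aS fin; have [[r [fr _]] fle] := inner_kkt n1 wb aS.
rewrite fr in fle; rewrite /gap fr /=.
have wb1 : (w.-1 <= wbar)%N by case/andP: wb => _; apply/leq_trans/leq_pred.
have := conjugate_ub (ip := @bdot R V m) (fapprox T n w.-1 a) (xs T n w) (z n w.-1 a).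
rewrite -/(dconj n w.-1 a); move: fin; case: (dconj _ _ _) => // c _.
have := fapprox_neqNy a (xs T n w) n1 wb1.
move: fle; case: (fapprox _ _ _ _ _) => // s.
rewrite -EFinB !lee_fin /=; lra.
Qed.

Lemma xsB n w n' w' : xs T n w - xs T n' w' = vA T n' w' - vA T n w.
Proof. by rewrite /xs opprB addrC addrA subrK. Qed.

(** Fenchel equality for the new blocks rewrites the change of the conjugates as gaps plus inner
    products with the new point. These inner products combine with the quadratic term into half the
    squared move. *)
Lemma Fapprox_step n w : (1 <= n)%N -> (1 <= w <= wbar)%N ->
  (-oo < Fapprox T n w.-1)%E ->
  (forall a, a \in S n w -> 0 <= gap n w a) /\
  Fapprox T n w = (fine (Fapprox T n w.-1)
    + 2^-1 * bnorm (vA T n w - vA T n w.-1) ^+ 2 + \sum_(a in S n w) gap n w a)%:E.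
Proof.
move=> n1 wb Fy.
have wb1 : (w.-1 <= wbar)%N by case/andP: wb => _; apply/leq_trans/leq_pred.
have fin0 := dconj_fin n1 wb1 Fy.
have gap0 a : a \in S n w -> 0 <= gap n w a by move=> aS; apply: gap_ge0.
split=> //; have [_ _ _ hz] := run_inner n1 wb.
have dE a : dconj n w a = (fine (dconj n w.-1 a) - (if a \in S n w then
    gap n w a + bdot (xs T n w) (z n w.-1 a - z n w a) else 0))%:E.
  case: ifPn => [aS|aS]; last first.
    by rewrite subr0 fineK// /dconj fapprox_notS// hz.
  have [[r hr] _] := inner_kkt n1 wb aS.
  rewrite /dconj (subgradient_conjugate hbip hr) (ipBr hbip) /gap -/(dconj n w.-1 a).
  by case: hr => -> _; congr (_%:E) => /=; ring.
rewrite (Fapprox_fin fin0) (@Fapprox_fin n w); last by move=> a; rewrite dE.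
congr (_%:E); rewrite [\sum_a _](eq_bigr (fun a => fine (dconj n w.-1 a)
  - (if a \in S n w then gap n w a + bdot (xs T n w) (z n w.-1 a - z n w a)
     else 0))) => [|a _]; last by rewrite dE.
rewrite big_split/= sumrN -big_mkcond/= big_split/= -(ip_sumr hbip).
have -> : \sum_(a in S n w) (z n w.-1 a - z n w a) = xs T n w - xs T n w.-1.
  rewrite xsB !vAE -sumrB [RHS](bigID (mem (S n w)))/= [X in _ + X]big1 ?addr0//.
  by move=> a /hz ->; rewrite subrr.
have -> : vA T n w - vA T n w.-1 = xs T n w.-1 - xs T n w by rewrite xsB.
move: (xs T n w) (xs T n w.-1) => x1 x0.
rewrite /bnorm !(ip_sqr hbip) !(ipE hbip) (ipC hbip x0 x1) /=.
set G := \sum_(a in _) _; set D := \sum_a _; lra.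
Qed.

Lemma xs_transfer n : (1 <= n)%N -> xs T n.+1 0 = xs T n wbar.
Proof.
move=> n1; case: (run_transfer n1) => zE vE _; rewrite /xs /vA vE.
by congr (_ - (_ + _)); apply: eq_bigr.
Qed.

Lemma dconj_edge n w b : (1 <= n)%N -> (w <= wbar)%N -> dconj n w (inr b) = 0%:E.
Proof. by move=> n1 wb; apply: conjugate_edge; apply: z_orth. Qed.

Lemma dconj_transfer n a : (1 <= n)%N -> dconj n.+1 0 a = dconj n wbar a.
Proof.
move=> n1; case: a => [i|b]; last by rewrite !dconj_edge.
rewrite /dconj; case: (run_transfer n1) => -> _ hg; congr (conjugate _ _ _).
by apply/funext => x /=; case: ifPn => // iv; rewrite hg.
Qed.

Lemma Fapprox_transfer n : (1 <= n)%N -> Fapprox T n.+1 0 = Fapprox T n wbar.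
Proof.
move=> n1; rewrite !FapproxE xs_transfer//; congr (_ - _)%E.
by apply: eq_bigr => a _; apply: dconj_transfer.
Qed.

Hypothesis hcov : full_coverage wbar T.

Lemma kkt_last n a : (1 <= n)%N -> a \in updated wbar T n ->
  exists r, subgradient_at (@bdot R V m) (fapprox T n wbar a)
    (xs T n (plast wbar T n a)) r (z n wbar a).
Proof.
move=> n1 /plast_updated[pb aS].
have [-> ->] : z n wbar a = z n (plast wbar T n a) a /\
    fapprox T n wbar a = fapprox T n (plast wbar T n a) a.
  by apply: plast_stable; rewrite ?plast_le//=.
by have [] := inner_kkt n1 pb aS.
Qed.

Lemma Fapprox_wbar n : (1 <= n)%N -> (-oo < Fapprox T n wbar)%E.
Proof.
move=> n1; rewrite Fapprox_fin ?ltNyr// => -[i|b]; last by rewrite dconj_edge.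
have [r /(subgradient_conjugate hbip) h] := kkt_last n1 ((hcov n1).2 i).
by rewrite /dconj h.
Qed.

(** Finiteness starts at the end of iteration 1, passes through the transfer, and is preserved by
    each later step. *)
Lemma Fapprox_gtNy n w : (2 <= n)%N -> (w <= wbar)%N -> (-oo < Fapprox T n w)%E.
Proof.
case: n => // n n1; elim: w => [_|w IH wb].
  by rewrite Fapprox_transfer// Fapprox_wbar.
by have [_ ->] := @Fapprox_step n.+1 w.+1 isT wb (IH (ltnW wb)); rewrite ltNyr.
Qed.

Local Notation Fr := (dual_value T).

Lemma Fapprox_lty n w : (1 <= n)%N -> (w <= wbar)%N -> (Fapprox T n w < +oo)%E.
Proof.
move=> n1 wb; rewrite ltey FapproxE.
case e: (\sum_a _)%E => [s| |]//.
move: e => /esum_eqNyP[b [_ _ bN]].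
by have := dconj_gtNy b n1 wb; rewrite bN.
Qed.

Lemma FrE n w : (2 <= n)%N -> (w <= wbar)%N -> Fapprox T n w = (Fr n w)%:E.
Proof.
move=> n2 wb; rewrite dual_value.unlock fineK// fin_numElt Fapprox_gtNy// Fapprox_lty//.
exact: ltnW.
Qed.

Lemma Fr_wbarE n : (1 <= n)%N -> Fapprox T n wbar = (Fr n wbar)%:E.
Proof.
by move=> n1; rewrite dual_value.unlock fineK// fin_numElt Fapprox_wbar// Fapprox_lty.
Qed.

Lemma Fr_step n w : (2 <= n)%N -> (1 <= w <= wbar)%N ->
  (forall a, a \in S n w -> 0 <= gap n w a) /\
  Fr n w = Fr n w.-1 + 2^-1 * bnorm (vA T n w - vA T n w.-1) ^+ 2
            + \sum_(a in S n w) gap n w a.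
Proof.
move=> n2 wb; have n1 := ltnW n2.
have wb1 : (w.-1 <= wbar)%N by case/andP: wb => _; apply/leq_trans/leq_pred.
have [g0 FE] := Fapprox_step n1 wb (Fapprox_gtNy n2 wb1).
by split=> //; rewrite !dual_value.unlock FE.
Qed.

Lemma Fr_transfer n : (1 <= n)%N -> Fr n.+1 0 = Fr n wbar.
Proof. by move=> n1; rewrite dual_value.unlock Fapprox_transfer. Qed.

Lemma Fr_inner n w : (2 <= n)%N -> (w <= wbar)%N ->
  Fr n 0 + \sum_(1 <= w' < w.+1) 2^-1 * bnorm (vA T n w' - vA T n w'.-1) ^+ 2
    <= Fr n w.
Proof.
move=> n2; elim: w => [_|w IH wb]; first by rewrite big_geq// addr0.
have [g0 ->] := @Fr_step n w.+1 n2 wb.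
rewrite big_nat_recr//= addrA -[leLHS]addr0 lerD ?sumr_ge0//.
by rewrite lerD2r IH// ltnW.
Qed.

Lemma Fr_inner_le n w w' : (2 <= n)%N -> (w <= w' <= wbar)%N -> Fr n w <= Fr n w'.
Proof.
move=> n2 /andP[]; elim: w' => [|w' IH]; first by rewrite leqn0 => /eqP ->.
rewrite leq_eqVlt => /orP[/eqP <-//|ww' wb].
apply: le_trans (IH ww' (ltnW wb)) _.
have [g0 ->] := @Fr_step n w'.+1 n2 wb.
by rewrite -addrA lerDl addr_ge0 ?sumr_ge0// mulr_ge0 ?sqr_ge0 ?invr_ge0.
Qed.

Lemma Fr_outer_le n n' : (1 <= n <= n')%N -> Fr n wbar <= Fr n' wbar.
Proof.
move=> /andP[n1]; elim: n' => [|n' IH]; first by rewrite leqn0 => /eqP ->.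
rewrite leq_eqVlt => /orP[/eqP <-//|nn'].
apply: le_trans (IH nn') _; have n'1 : (1 <= n')%N := leq_trans n1 (nn' : (n <= n')%N).
by rewrite -Fr_transfer// Fr_inner_le// leqnn.
Qed.

Lemma weak_duality n w (x : X) : (1 <= n)%N -> (w <= wbar)%N ->
  (Fapprox T n w + (2^-1 * bnorm (xs T n w - x)%R ^+ 2)%:E <= primal P x)%E.
Proof.
move=> n1 wb; have := @dual_le_primal _ _ _ P _ (z n w) x (fun a => fapprox_neqNy a x n1 wb).
rewrite -vAE => /le_trans; apply; rewrite /primal /fsum; apply: leeD2l.
by apply: lee_sum => a _; apply: fapprox_le.
Qed.

Lemma Fval_le_primal n w (x : X) : (Fval T n w <= primal P x)%E.
Proof.
have := @dual_le_primal _ _ _ P _ (z n w) x (fun a => fbold_neqNy a x).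
apply: le_trans; rewrite leeDl// lee_fin.
by rewrite mulr_ge0 ?sqr_ge0 ?invr_ge0.
Qed.

Lemma Fapprox_le_Fval n w : (1 <= n)%N -> (w <= wbar)%N ->
  (Fapprox T n w <= Fval T n w)%E.
Proof.
move=> n1 wb; apply: leeB => //; apply: lee_sum => a _.
by apply: le_conjugate => x; apply: fapprox_le.
Qed.

(** * Boundedness and model errors *)

Hypothesis hw : (0 < wbar)%N.
Hypothesis hfeas : exists x, (primal P x < +oo)%E.

Definition sqsum n : R :=
  \sum_(1 <= w < wbar.+1) bnorm (vA T n w - vA T n w.-1) ^+ 2.

Definition Fincr n : R := Fr n.+1 wbar - Fr n wbar.

Lemma sqsum_ge0 n : 0 <= sqsum n.
Proof. by apply: sumr_ge0 => w _; apply: sqr_ge0. Qed.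

Lemma sqsum_le n : (1 <= n)%N -> sqsum n.+1 <= 2 * Fincr n.
Proof.
move=> n1; have := @Fr_inner n.+1 wbar n1 (leqnn _).
by rewrite Fr_transfer// -mulr_sumr -/(sqsum _) /Fincr; lra.
Qed.

Lemma feasible_primal : exists x (p : R), primal P x = p%:E.
Proof.
have [x hx] := hfeas; exists x; have := @weak_duality 1%N wbar x isT (leqnn _).
rewrite Fr_wbarE//; case: (primal P x) hx => // p _ _; by exists p.
Qed.

Lemma Fr_wbar_bounded : exists B, forall n, (1 <= n)%N -> Fr n wbar <= B.
Proof.
have [x [p hp]] := feasible_primal; exists p => n n1.
have := @weak_duality n wbar x n1 (leqnn _).
rewrite Fr_wbarE// hp -EFinD lee_fin; apply: le_trans.
by rewrite lerDl mulr_ge0 ?sqr_ge0 ?invr_ge0.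
Qed.

(** The increments of the dual value telescope. The first term stays apart because the dual value
    may be -oo inside iteration 1. *)
Lemma sqsum_partial N : (1 <= N)%N ->
  \sum_(1 <= n < N.+1) sqsum n <= sqsum 1 + 2 * (Fr N wbar - Fr 1 wbar).
Proof.
elim: N => // -[_ _|N IH _]; first by rewrite big_nat1 subrr mulr0 addr0.
rewrite big_nat_recr//=; apply: le_trans (lerD (IH isT) (@sqsum_le N.+1 isT)) _.
by rewrite /Fincr -addrA -mulrDr lerD2l ler_pM2l// [leLHS]addrC subrKA.
Qed.

Lemma summable_increments : (\sum_(1 <= n <oo) (sqsum n)%:E < +oo)%E.
Proof.
have [B hB] := Fr_wbar_bounded.
apply: (@le_lt_trans _ _ (sqsum 1 + 2 * (B - Fr 1 wbar))%:E); last exact: ltry.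
apply: lime_le.
  by apply: is_cvg_nneseries => n _ _; rewrite lee_fin sqsum_ge0.
near=> N; have N2 : (2 <= N)%N by near: N; exists 2%N.
have N1 : (1 <= N.-1)%N by rewrite -ltnS prednK// ltnW.
rewrite sumEFin lee_fin -(prednK (ltnW N2)).
by apply: le_trans (sqsum_partial N1) _; have := hB _ N1; lra.
Unshelve. all: by end_near. Qed.

Lemma sqsum_summable_bound : exists B : R, forall N,
  \sum_(1 <= n < N) sqsum n <= B.
Proof.
have [B hB] := Fr_wbar_bounded.
exists (sqsum 1 + 2 * (B - Fr 1 wbar)) => -[|[|N]].
- by rewrite big_geq//; have := sqsum_ge0 1; have := hB 1%N isT; lra.
- by rewrite big_geq//; have := sqsum_ge0 1; have := hB 1%N isT; lra.
- by have := @sqsum_partial N.+1 isT; have := hB N.+1 isT; lra.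
Qed.

Lemma xs_bounded : exists2 rho, 0 <= rho & forall n w, (1 <= n)%N ->
  (w <= wbar)%N -> bnorm (xs T n w) <= rho.
Proof.
have [x [p hp]] := feasible_primal.
(* From iteration 2 on, the squared distance [d ^+ 2] to the feasible point [x] is at most
   [2 * (p - Fr 1 wbar)], and [d <= 1 + d ^+ 2]. Iteration 1 is covered by the finite sum [S1]. *)
pose D := 1 + 2 * (p - Fr 1 wbar) + bnorm x.
pose S1 := \sum_(0 <= w < wbar.+1) bnorm (xs T 1 w).
have S10 : 0 <= S1 by apply: sumr_ge0 => w _; apply: sqrtr_ge0.
have nx : 0 <= bnorm x by apply: sqrtr_ge0.
have pF : 0 <= p - Fr 1 wbar.
  have := @weak_duality 1%N wbar x isT (leqnn _).
  rewrite Fr_wbarE// hp -EFinD lee_fin.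
  have : 0 <= 2^-1 * bnorm (xs T 1 wbar - x) ^+ 2.
    by rewrite mulr_ge0 ?sqr_ge0 ?invr_ge0.
  lra.
exists (D + S1); first by rewrite /D; lra.
move=> [//|[|n]] w _ wb.
  apply: (@le_trans _ _ S1); last by rewrite /D; lra.
  rewrite /S1 (bigD1_seq w) ?iota_uniq ?mem_index_iota//= lerDl.
  by apply: sumr_ge0 => ? _; apply: sqrtr_ge0.
apply: (@le_trans _ _ D); last by lra.
have := @weak_duality n.+2 w x isT wb; rewrite FrE// hp -EFinD lee_fin => h.
have h1 : Fr 1 wbar <= Fr n.+2 w.
  apply: (@le_trans _ _ (Fr n.+2 0)); last exact: Fr_inner_le.
  by rewrite Fr_transfer// Fr_outer_le.
have tri := ip_triangle hbip (xs T n.+2 w - x) x.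
rewrite subrK -/(bnorm _) -/(bnorm _) -/(bnorm _) in tri.
apply: (le_trans tri); rewrite /D lerD2r.
set d := bnorm _ in h *; have : d ^+ 2 <= 2 * (p - Fr 1 wbar) by lra.
have : 0 <= (d - 1) ^+ 2 by apply: sqr_ge0.
have : 0 <= d by apply: sqrtr_ge0.
rewrite sqrrB1 expr2; nra.
Qed.

Lemma vA_bounded : exists C : R, forall n w, (1 <= n)%N ->
  (1 <= w <= wbar)%N -> bnorm (vA T n w) ^+ 2 <= C.
Proof.
have [rho rho0 hr] := xs_bounded; exists ((bnorm (xbar P) + rho) ^+ 2).
move=> n w n1 /andP[_ wb].
have nb : 0 <= bnorm (xbar P) by apply: sqrtr_ge0.
rewrite lerXn2r ?nnegrE ?sqrtr_ge0 ?addr_ge0//.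
have -> : vA T n w = xbar P - xs T n w by rewrite /xs subKr.
rewrite (le_trans (ip_triangle hbip _ _))// (ip_normN hbip).
by rewrite lerD2l hr.
Qed.

Lemma enorm_xs_bounded : exists2 rho, 0 <= rho & forall n w i, (1 <= n)%N ->
  (w <= wbar)%N -> enorm (xs T n w i) <= rho.
Proof.
have [rho rho0 hr] := xs_bounded; exists rho => // n w i n1 wb.
exact: le_trans (enorm_le_bnorm _ _) (hr _ _ n1 wb).
Qed.

Lemma bnorm_vertex n w i : (1 <= n)%N -> (w <= wbar)%N ->
  bnorm (z n w (inl i)) = enorm (z n w (inl i) i).
Proof.
move=> n1 wb; rewrite /bnorm (@bdot_supp _ _ _ _ _ i)// => j.
exact: z_supp.
Qed.

(** At each update the block is a subgradient of the finite function [fv P i] at a point of a fixed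
    ball; between updates it is constant. *)
Lemma bounded3 i : i \in vert3 P -> exists C, forall n w, (1 <= n)%N ->
  (w <= wbar)%N -> enorm (z n w (inl i) i) <= C.
Proof.
move=> iv; have i4 : i \notin vert4 P.
  by case: hP => _ /(_ i) + _ _ _; rewrite iv; case: (i \in vert4 P) => //;
    rewrite addn1 addnC.
have [fE cf] : (forall x, fv P i x = (fine (fv P i x))%:E) /\
  convex_fun (fun x => fine (fv P i x)) by apply: full_fv; rewrite iv.
have [rho rho0 hr] := enorm_xs_bounded.
have [M [M0 hM hs hs']] := subgradient_enorm_le rho cf.
exists (enorm (z 1 0 (inl i) i) + (M + M)); apply: run_ind.
- by rewrite lerDl addr_ge0.
- move=> n w n1 wb IH; have [_ _ _ hz] := run_inner n1 wb.
  have [iS|/hz -> //] := boolP (inl i \in S n w).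
  have [kk _] := inner_kkt n1 wb iS.
  have [r [[]]] := kkt_vertex kk; rewrite (negPf i4) => fr sub _.
  have wb2 : (w <= wbar)%N by case/andP: wb.
  have rE : r = fine (fv P i (xs T n w i)) by rewrite fr.
  have xr := hr n w i n1 wb2.
  apply: (@le_trans _ _ (M + M)); last by rewrite lerDr sqrtr_ge0.
  apply: hs' xr _ => y; rewrite -lee_fin -(fE y) -rE; exact: sub.
- by move=> n n1; have [-> _ _] := run_transfer n1.
Qed.

(** From here on each outer iteration after the first opens by cutting all nonsmooth terms. So from
    step (2, 1) on every model is affine with slope the current dual block: a cut creates this
    situation, and a block step cannot move the block. *)
Hypothesis hA3 : starts_with_cuts T.

Lemma affine_models i : i \in vert4 P -> exists K, 0 <= K /\
  forall n w, (1 <= n)%N -> (w <= wbar)%N ->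
  (2 <= n)%N -> (n == 2%N -> 1 <= w)%N ->
  (exists r, forall x, g n w i x = r + dot x (z n w (inl i) i)) /\
  enorm (z n w (inl i) i) <= K.
Proof.
move=> iv; have [fE cf] := fv4 iv; have [rho rho0 hr] := enorm_xs_bounded.
have [M [M0 hM hs hs']] := subgradient_enorm_le rho cf.
(* A new slope is at most [M - hx], and [hx] is at least the linearization at [y]. That is at least
   [- M - 2 * M * (2 * rho)]: subgradients are bounded by [2 * M], and [x] and [y] lie in the ball
   of radius [rho]. *)
exists (M + (M + 2 * M * (2 * rho))).
split; first by rewrite !addr_ge0 ?mulr_ge0.
apply: run_ind => //; last first.
  move=> n n1 IH _ n2; have [zE _ gE] := run_transfer n1.
  have n2' : (2 <= n)%N by case: n n1 n2 {IH zE gE} => [|[|n]]// _ /(_ isT).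
  by rewrite zE gE//; apply: IH.
move=> n w n1 wb IH n2 nw; have [_ _ + hz] := run_inner n1 wb.
have wb1 : (w.-1 <= wbar)%N by case/andP: wb => _; apply/leq_trans/leq_pred.
have wb2 : (w <= wbar)%N by case/andP: wb.
have [sub cut|nsub hb] := boolP (S n w \subset idx4 P).
  have [iS|iS] := boolP (inl i \in S n w); last first.
    rewrite hz//; case: cut => _ /(_ i iv iS) ->; apply: IH => //.
    (* Here [w] is not 1, since the first step of iteration 2 cuts every vertex of [vert4 P]. *)
    move=> n_2; case: w wb iS {sub hz nw wb1 wb2} => [|[|w]]//.
    by rewrite hA3// mem_idx4 iv.
  have [s [hx [sg gE [_ hx_ge]]]] := cut_facts n1 wb sub iS.
  set x := xs T n w i in gE hx_ge; set y := xs T n w.-1 i in sg hx_ge.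
  split.
    exists (hx - dot x (z n w (inl i) i)) => x'.
    by rewrite gE (ipBl hip); ring.
  have xr : enorm x <= rho by apply: hr.
  have yr : enorm y <= rho by apply: hr.
  have [_ gf] := model_inv n1 wb2 iv.
  have nz : enorm (z n w (inl i) i) <= M - hx.
    have gx : g n w i x = hx by rewrite gE subrr (ip0l hip) addr0.
    rewrite -gx; apply: (hs (g n w i)) => // x'.
      by rewrite -lee_fin -fE; apply: gf.
    by rewrite gx gE (ipC hip).
  have ns : enorm s <= M + M.
    by apply: hs' yr _ => y'; rewrite -lee_fin EFinD -!fE; apply: sg.
  have nxy : enorm (x - y) <= 2 * rho.
    rewrite (le_trans (ip_triangle hip _ _))// (ip_normN hip).
    by rewrite mulr_natl mulr2n lerD.
  have := ip_cauchy hip s (x - y); rewrite -/(enorm s) -/(enorm _) => hc.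
  have : enorm s * enorm (x - y) <= 2 * M * (2 * rho).
    by apply: ler_pM; rewrite ?sqrtr_ge0// mulr_natl mulr2n.
  have := hM _ yr; have := ler_norm (- dot s (x - y)).
  rewrite normrN ler_norml => h1 /andP[h2 _] h3; lra.
have [gE hmin] := hb; rewrite gE//.
have nw1 : n == 2%N -> (1 <= w.-1)%N.
  move=> /eqP n_2; move: nsub; case: w wb {hz hb IH nw wb1 wb2 gE hmin} => [|[|w]]//.
  by rewrite n_2 hA3// fintype.subxx.
have [[r hg] nz] := IH n2 nw1.
have [iS|/hz -> //] := boolP (inl i \in S n w); last by split=> //; exists r.
have [kk _] := inner_kkt n1 wb iS.
have [c [hc _]] := kkt_vertex kk.
(* The model is affine and unchanged, so its only subgradient is the old slope. *)
have -> : z n w (inl i) i = z n w.-1 (inl i) i.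
  apply: affine_subgradient hc => x; rewrite iv gE//.
  by congr (_%:E); apply: hg.
by split=> //; exists r.
Qed.

Lemma bounded34 i : (i \in vert3 P) || (i \in vert4 P) ->
  exists C : R, forall n w, (1 <= n)%N -> (1 <= w <= wbar)%N ->
    bnorm (z n w (inl i)) <= C.
Proof.
case/orP => iv.
  have [C hC] := bounded3 iv; exists C => n w n1 /andP[_ wb].
  by rewrite bnorm_vertex// hC.
have [K [K0 hK]] := affine_models iv.
pose S1 := \sum_(0 <= w < wbar.+1) bnorm (z 1 w (inl i)).
have S10 : 0 <= S1 by apply: sumr_ge0 => w _; apply: sqrtr_ge0.
exists (S1 + K) => -[//|[|n]] w _ /andP[w1 wb].
  apply: (@le_trans _ _ S1); last by rewrite lerDl.
  rewrite /S1 (bigD1_seq w) ?iota_uniq ?mem_index_iota//= lerDl.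
  by apply: sumr_ge0 => ? _; apply: sqrtr_ge0.
rewrite bnorm_vertex//; apply: (@le_trans _ _ K); last by rewrite lerDr.
by have [] := hK n.+2 w isT wb isT (fun=> w1).
Qed.

Hypothesis hA2 : no_late_edges wbar T.

(** After the last update of [i] no edge at [i] is updated, and the blocks of the other edges vanish
    at [i]. Block [i] of the primal iterate is thus frozen, although other blocks may move. *)
Lemma xs_after_plast n w i : (1 <= n)%N -> i \in vert4 P ->
  (plast wbar T n (inl i) <= w <= wbar)%N ->
  xs T n w i = xs T n (plast wbar T n (inl i)) i.
Proof.
move=> n1 iv /andP[pw wb]; have pb := leq_trans pw wb.
rewrite !xs_coord// !ffunE.
have [-> _] : z n w (inl i) = z n (plast wbar T n (inl i)) (inl i) /\
    fapprox T n w (inl i) = fapprox T n (plast wbar T n (inl i)) (inl i).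
  by apply: plast_stable => //; rewrite pw.
congr (_ - _ - _); elim: w pw wb => [|w IH].
  by rewrite leqn0 => /eqP ->.
rewrite leq_eqVlt => /orP[/eqP <-//|pw] wb.
rewrite -IH ?(ltnW wb)// /vH !sum_ffunE; apply: eq_bigr => b _.
have [_ _ _ hz] := @run_inner n w.+1 n1 wb.
have [bS|/hz -> //] := boolP (inr b \in S n w.+1).
have ib : i \notin val b.1.
  apply/negP => ib; have pwb : (plast wbar T n (inl i) < w.+1 <= wbar)%N.
    by rewrite pw.
  by have := hA2 n1 iv pwb ib; rewrite bS.
by rewrite !(orthogonal_edge_supp _ ib)//; apply: z_orth => //; apply: ltnW.
Qed.

Lemma bdot_vertex n w i (u : X) : (1 <= n)%N -> (w <= wbar)%N ->
  bdot u (z n w (inl i)) = dot (u i) (z n w (inl i) i).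
Proof.
move=> n1 wb; rewrite (ipC hbip u) (ipC hip (u i)).
by apply: bdot_supp => j ji; apply: z_supp.
Qed.

Lemma fbold_last n a : (1 <= n)%N -> a \in updated wbar T n -> a \notin idx4 P ->
  exists r, fbold a (xs T n (plast wbar T n a)) = r%:E.
Proof.
move=> n1 aU a4; have [pb aS] := plast_updated aU.
have [[r [hr _]] _] := inner_kkt n1 pb aS; exists r.
by rewrite -hr fapprox_notin.
Qed.

Lemma Eerr_exact a n : a \notin idx4 P -> (1 <= n)%N ->
  a \in updated wbar T n -> Eerr wbar T a n = 0%E.
Proof.
move=> a4 n1 aU; have [r hr] := fbold_last n1 aU a4.
by rewrite /Eerr fapprox_notin// hr subee.
Qed.

Lemma increment_le n w : (1 <= w <= wbar)%N ->
  bnorm (vA T n w - vA T n w.-1) <= Num.sqrt (sqsum n).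
Proof.
move=> wb; rewrite -[leLHS]ger0_norm ?sqrtr_ge0// -sqrtr_sqr ler_sqrt ?sqsum_ge0//.
rewrite /sqsum (bigD1_seq w) ?iota_uniq ?mem_index_iota ?ltnS//= lerDl.
by apply: sumr_ge0 => ? _; apply: sqr_ge0.
Qed.

Lemma gap_le_Fincr n a : (1 <= n)%N -> a \in S n.+1 1 -> gap n.+1 1 a <= Fincr n.
Proof.
move=> n1 aS; have [g0 FE] := @Fr_step n.+1 1 n1 hw.
have := @Fr_inner_le n.+1 1 wbar n1; rewrite hw leqnn => /(_ isT).
rewrite FE Fr_transfer// (bigD1 a)//= /Fincr => h.
rewrite lerBrDr; apply: le_trans h; rewrite [leLHS]addrC -[leRHS]addrA lerD2l.
rewrite addrCA lerDl addr_ge0//; first by rewrite mulr_ge0 ?sqr_ge0 ?invr_ge0.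
by apply: sumr_ge0 => b /andP[bS _]; apply: g0.
Qed.

(** The error is measured at the final point [y] of iteration [n], exactly where step (n + 1, 1)
    places its cut. Raising the model from [g] to the linearization there shows up in the gap of
    that step, up to inner products of the move [x - y] with [s] and with the dual block. *)
Lemma Eerr_le i : i \in vert4 P -> exists2 L, 0 <= L & forall n, (2 <= n)%N ->
  exists e : R, [/\ Eerr wbar T (inl i) n = e%:E, 0 <= e &
    e <= Fincr n + L * Num.sqrt (sqsum n.+1)].
Proof.
move=> iv; have [fE cf] := fv4 iv; have [K [K0 hK]] := affine_models iv.
have [rho rho0 hr] := enorm_xs_bounded.
have [M [M0 _ _ hs']] := subgradient_enorm_le rho cf.
(* [K] bounds the dual block and [M + M] the subgradient [s]; each is paired with the move. *)
exists (K + (M + M)); first by rewrite !addr_ge0.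
move=> n n2; have n1 := ltnW n2; set y := xs T n wbar i.
have [[r hg] nz] := hK n wbar n1 (leqnn _) n2 (fun=> hw).
have hp : (plast wbar T n (inl i) <= wbar <= wbar)%N by rewrite plast_le leqnn.
exists (fine (fv P i y) - g n wbar i y); split.
- rewrite /Eerr /= iv -(xs_after_plast n1 iv hp) -/y EFinB -fE; congr (_ - _)%E.
  have [_ /(congr1 (fun h => h [ffun=> y]))] := plast_stable n1 hp.
  by rewrite /= iv ffunE => <-.
- have [_ gf] := model_inv n1 (leqnn _) iv.
  by rewrite subr_ge0 -lee_fin -fE gf.
have w1b : (1 <= 1 <= wbar)%N by [].
have Sn : S n.+1 1 = idx4 P by rewrite hA3.
have iS : inl i \in S n.+1 1 by rewrite Sn mem_idx4.
have sub : S n.+1 1 \subset idx4 P by rewrite Sn fintype.subxx.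
have [zT _ gT] := run_transfer n1.
have [s [hx [sg gE [_ hx_ge]]]] := @cut_facts n.+1 1%N i isT w1b sub iS.
rewrite /= xs_transfer// -/y in sg hx_ge gE.
set x := xs T n.+1 1 i in gE hx_ge.
have gapE : gap n.+1 1 (inl i) = dot (y - x) (z n wbar (inl i) i) - g n wbar i y + hx.
  rewrite /gap /= iv zT gE subrr (ip0l hip) addr0; congr (_ + _).
  (* The old model is affine with slope the dual block, so Fenchel equality holds at every point, in
     particular at [y]. *)
  have -> : dconj n.+1 0 (inl i) =
      (bdot (xs T n wbar) (z n wbar (inl i)) - g n wbar i y)%:E.
    rewrite /dconj zT; apply: (subgradient_conjugate hbip).
    apply/(@subgradient_lift R V m (fun x =>
      if i \in vert4 P then (g n.+1 0 i x)%:E else fv P i x)).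
    split; last by move=> j; apply: z_supp.
    rewrite iv gT// -/y hg.
    by apply: affine_subgradient_at => y'; rewrite hg.
  by rewrite /= !bdot_vertex// (ipBl hip) -/x -/y; ring.
have gle := gap_le_Fincr n1 iS.
have xyd : enorm (x - y) <= Num.sqrt (sqsum n.+1).
  have := @increment_le n.+1 1 w1b; apply: le_trans.
  have -> : x - y = - (vA T n.+1 1 - vA T n.+1 0) i.
    rewrite /x /y -xs_transfer// -[RHS]opprK -[LHS]opprK; congr (- _).
    by rewrite !opprB opprK -xsB !ffunE.
  by rewrite [leLHS](ip_normN hip); apply: enorm_le_bnorm.
have yr : enorm y <= rho by apply: hr.
have ns : enorm s <= M + M.
  by apply: hs' yr _ => y'; rewrite -lee_fin EFinD -!fE; apply: sg.
have d0 : 0 <= enorm (x - y) by apply: sqrtr_ge0.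
have c1 : `|dot s (x - y)| <= enorm s * enorm (x - y) := ip_cauchy hip _ _.
set t := z n wbar (inl i) i in nz gapE.
have c2 : `|dot (x - y) t| <= enorm (x - y) * enorm t := ip_cauchy hip _ _.
have e1 : enorm s * enorm (x - y) <= (M + M) * Num.sqrt (sqsum n.+1).
  by apply: ler_pM; rewrite ?sqrtr_ge0.
have e2 : enorm (x - y) * enorm t <= K * Num.sqrt (sqsum n.+1).
  by rewrite mulrC; apply: ler_pM; rewrite ?sqrtr_ge0.
have b1 : - dot s (x - y) <= (M + M) * Num.sqrt (sqsum n.+1).
  by apply: le_trans e1; apply: le_trans c1; rewrite -normrN ler_norm.
have b2 : dot (x - y) t <= K * Num.sqrt (sqsum n.+1).
  by apply: le_trans e2; apply: le_trans c2; rewrite ler_norm.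
rewrite mulrDl addrA; apply: le_trans (lerD (lerD gle b2) b1).
rewrite gapE -(opprB x y) (ipNl hip).
set p := dot (x - y) t; set q := dot s (x - y); set u := g n wbar i y.
have -> : - p - u + hx + p + - q = hx - q - u by ring.
by rewrite lerD2r lerBrDr.
Qed.

Lemma Fr_wbar_cvg : exists l : R, Fr n wbar @[n --> \oo] --> l.
Proof.
have [B hB] := Fr_wbar_bounded.
exact: (@nondecreasing_from1_cvg R (fun n => Fr n wbar) B Fr_outer_le hB).
Qed.

Lemma Fincr_cvg : Fincr n @[n --> \oo] --> (0 : R).
Proof. by have [l hl] := Fr_wbar_cvg; exact: cvg_increments hl. Qed.

Lemma sqsum_cvg : sqsum n @[n --> \oo] --> (0 : R).
Proof.
rewrite -(cvg_shiftS sqsum).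
have h : (fun n => 2 * Fincr n) @ \oo --> (0 : R).
  by rewrite -(mulr0 2); apply: cvgMr => //; apply: Fincr_cvg.
apply: (squeeze_cvgr _ (cvg_cst _) h).
near=> n; rewrite sqsum_ge0 sqsum_le//; near: n; by exists 1%N.
Unshelve. all: by end_near. Qed.

Lemma sqrt_sqsum_cvg : Num.sqrt (sqsum n) @[n --> \oo] --> (0 : R).
Proof.
rewrite -[X in _ --> X](@sqrtr0 R).
by apply: (@continuous_cvg _ _ _ _ _ _ Num.sqrt); [exact: sqrt_continuous|exact: sqsum_cvg].
Qed.

Lemma Eerr_cvg i : i \in vert4 P -> Eerr wbar T (inl i) n @[n --> \oo] --> 0%E.
Proof.
move=> /Eerr_le[L L0 hL]; apply/fine_cvgP; split.
  by exists 2%N => // n /= /hL[e [-> _ _]].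
have h : (fun n => Fincr n + L * Num.sqrt (sqsum n.+1)) @ \oo --> (0 : R).
  rewrite -[X in _ --> X](addr0 (0 : R)); apply: cvgD; first exact: Fincr_cvg.
  rewrite -(mulr0 L); apply: cvgMr.
  by rewrite (cvg_shiftS (fun n => Num.sqrt (sqsum n))); apply: sqrt_sqsum_cvg.
apply: (squeeze_cvgr _ (cvg_cst _) h).
by exists 2%N => // n /= /hL[e [-> ? ?]] /=; apply/andP.
Qed.

(** * The limit point *)

Local Notation pl n a := (plast wbar T n a).

(** Telescope over at most [wbar] steps, each bounded by the root of the sum of squares. *)
Lemma drift_le n w : (w <= wbar)%N ->
  bnorm (vA T n wbar - vA T n w) <= wbar%:R * Num.sqrt (sqsum n).
Proof.
have s0 : 0 <= Num.sqrt (sqsum n) by apply: sqrtr_ge0.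
suff h d w' : (w' + d <= wbar)%N ->
    bnorm (vA T n (w' + d) - vA T n w') <= d%:R * Num.sqrt (sqsum n).
  move=> wb; have := h (wbar - w)%N w; rewrite subnKC// => /(_ (leqnn _)).
  by move=> /le_trans; apply; rewrite ler_wpM2r// ler_nat leq_subr.
elim: d w' => [|d IH] w' wb.
  by rewrite addn0 subrr mul0r /bnorm (ip0l hbip) sqrtr0.
have wb1 : (w'.+1 <= wbar)%N by apply: leq_trans wb; rewrite addnS ltnS leq_addr.
have -> : vA T n (w' + d.+1) - vA T n w' =
    (vA T n (w'.+1 + d) - vA T n w'.+1) + (vA T n w'.+1 - vA T n w'.+1.-1).
  by rewrite subrKA addSnnS.
rewrite (le_trans (ip_triangle hbip _ _))// -natr1 mulrDl mul1r.
by apply: lerD; [apply: IH; rewrite addSnnS|apply: increment_le].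
Qed.

Lemma sub_bnorm_le (x y : X) i k : `|x i 0 k - y i 0 k| <= bnorm (x - y).
Proof.
apply: le_trans (enorm_le_bnorm (x - y) i).
by have := coord_le_enorm ((x - y) i) k; rewrite !ffunE !mxE.
Qed.

Lemma not_updated n w a : (1 <= n)%N -> (w <= wbar)%N ->
  a \notin updated wbar T n -> z n w a = z n 0 a.
Proof.
move=> n1 + aU; elim: w => // w IH wb.
have [_ _ _ hz] := @run_inner n w.+1 n1 wb.
rewrite hz ?IH//; first exact: ltnW.
by apply: contra aU => aS; apply/updatedP; exists w.+1.
Qed.

Lemma inactive_edge n b : (1 <= n)%N -> inr b \notin updated wbar T n ->
  z n wbar (inr b) = 0.
Proof.
move=> n1 bU; rewrite not_updated//; have [_ + _ _] := run_edge n1.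
by apply; have [-> _] := hcov n1; rewrite inE.
Qed.

Definition model_value n i :=
  fine (fapprox T n wbar (inl i) (xs T n (pl n (inl i)))).

Definition model_error i n := fine (Eerr wbar T (inl i) n).

Lemma fv_last n i : (1 <= n)%N ->
  fv P i (xs T n (pl n (inl i)) i) = (model_value n i + model_error i n)%:E.
Proof.
move=> n1; have iU := (hcov n1).2 i; rewrite /model_value /model_error.
have [iv|iv] := boolP (i \in vert4 P).
  have [fE _] := fv4 iv; have hp : (pl n (inl i) <= wbar <= wbar)%N.
    by rewrite plast_le leqnn.
  have [_ ->] := plast_stable n1 hp.
  by rewrite /Eerr /= iv fE -EFinB /= addrC subrK.
have i4 : inl i \notin idx4 P by rewrite mem_idx4.
have [r hr] := fbold_last n1 iU i4.
by rewrite Eerr_exact// fapprox_notin// hr /= addr0.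
Qed.

(* The optimality conditions at the last update of each dual block turn the
   conjugates into function values, up to the drift since that update. *)
Lemma Fr_wbar_formula n : (1 <= n)%N -> Fr n wbar =
  2^-1 * bnorm (vA T n wbar) ^+ 2 - \sum_a pinner wbar T a n
  + \sum_i model_value n i.
Proof.
move=> n1.
pose val (a : idx P) := if a is inl i then model_value n i else 0.
have dE a : dconj n wbar a = (bdot (xs T n wbar) (z n wbar a)
    + pinner wbar T a n - val a)%:E.
  have [aU|aU] := boolP (a \in updated wbar T n); last first.
    case: a aU => [i|b] aU; first by rewrite (hcov n1).2 in aU.
    rewrite dconj_edge// inactive_edge// (ip0r hbip) /pinner (negPf aU).
    by rewrite addr0 subr0.
  have [r hr] := kkt_last n1 aU; rewrite /dconj (subgradient_conjugate hbip hr).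
  congr (_%:E); rewrite /pinner aU -xsB (ipBl hbip (xs T n _)).
  suff -> : r = val a by rewrite [X in _ = X - _]addrC subrK.
  by case: a hr {aU} => [i [hr _]|b /subgradient_edge[]//]; rewrite /= /model_value hr.
apply: EFin_inj; rewrite -Fr_wbarE// Fapprox_fin; last by move=> a; rewrite dE.
congr (_%:E).
rewrite (eq_bigr (fun a => bdot (xs T n wbar) (z n wbar a)
    + pinner wbar T a n - val a)) => [|a _]; last by rewrite dE.
rewrite sumrB big_split/= -(ip_sumr hbip) -vAE.
have -> : \sum_a val a = \sum_i model_value n i.
  by rewrite big_sumType/= [X in _ + X]big1 ?addr0.
have -> : xbar P = xs T n wbar + vA T n wbar by rewrite /xs subrK.
move: (\sum_a _) (\sum_i _) (xs _ _ _) (vA _ _ _) => p q x v.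
rewrite /bnorm !(ip_sqr hbip) !(ipE hbip) (ipC hbip v x); lra.
Qed.

(** Cauchy-Schwarz of drift against dual block, arranged so that growth and move meet in the single
    product [sqsum n * n%:R]. *)
Lemma pinner_le n a (A B : R) : (1 <= n)%N ->
  \sum_(a : idx P) bnorm (z n wbar a) <= A * Num.sqrt n%:R + B ->
  `|pinner wbar T a n| <= wbar%:R *
     (`|A| * Num.sqrt (sqsum n * n%:R) + `|B| * Num.sqrt (sqsum n)).
Proof.
move=> n1 hs.
have s0 : 0 <= Num.sqrt (sqsum n) by apply: sqrtr_ge0.
have -> : wbar%:R * (`|A| * Num.sqrt (sqsum n * n%:R) + `|B| * Num.sqrt (sqsum n))
  = (wbar%:R * Num.sqrt (sqsum n)) * (`|A| * Num.sqrt n%:R + `|B|).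
  by rewrite sqrtrM ?sqsum_ge0//; ring.
have r0 : 0 <= wbar%:R * Num.sqrt (sqsum n) by rewrite mulr_ge0.
have z0 : 0 <= `|A| * Num.sqrt n%:R + `|B| by rewrite addr_ge0 ?mulr_ge0 ?sqrtr_ge0.
rewrite /pinner; case: ifP => _; last by rewrite normr0 mulr_ge0.
apply: (le_trans (ip_cauchy hbip _ _)).
apply: ler_pM; rewrite ?sqrtr_ge0//; first exact: drift_le (plast_le _ _).
have hz : bnorm (z n wbar a) <= \sum_(a : idx P) bnorm (z n wbar a).
  by rewrite (bigD1 a)//= lerDl sumr_ge0// => b _; apply: sqrtr_ge0.
apply: (le_trans hz); apply: (le_trans hs).
by rewrite lerD ?ler_norm// ler_wpM2r ?sqrtr_ge0 ?ler_norm.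
Qed.

Lemma model_error_cvg i : model_error i @ \oo --> (0 : R).
Proof.
have [iv|iv] := boolP (i \in vert4 P).
  by have /fine_cvgP[] := Eerr_cvg iv.
apply: (@cvg_trans _ ((fun=> 0 : R) @ \oo)); last exact: cvg_cst.
apply: near_eq_cvg; exists 1%N => // n /= n1.
by rewrite /model_error Eerr_exact ?mem_idx4//; apply: (hcov n1).2.
Qed.

(** Two extractions: [sg] makes [sqsum n * n%:R] small, then [ta] makes the bounded [vA] converge
    along it. *)
Lemma good_subsequence : sqrt_growth wbar T ->
  exists (nk : nat -> nat) (vs : X),
  [/\ forall k, (1 <= nk k)%N,
      {homo nk : k l / (k < l)%N >-> (k < l)%N},
      (fun k => bnorm (vA T (nk k) wbar - vs)) @ \oo --> (0 : R)
    & forall a, (fun k => pinner wbar T a (nk k)) @ \oo --> (0 : R)].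
Proof.
move=> [A [B hAB]].
have i0 k : 0 < (k.+1%:R^-1 : R) by rewrite invr_gt0 ltr0Sn.
have [C hC] := sqsum_summable_bound.
have [sg [sgh sgP]] := @extract_subsequence
  (fun k n => (1 <= n)%N /\ sqsum n * n%:R <= k.+1%:R^-1)
  (fun k N => summable_small_often sqsum_ge0 hC N (i0 k)).
have [D hD] := vA_bounded.
have [|vs hvs] := @bounded_cluster R V m (fun k => vA T (sg k) wbar) (Num.sqrt D).
  move=> k; have [s1 _] := sgP k.
  rewrite /bnorm ler_wsqrtr// -(ip_sqr hbip); apply: hD => //.
  by rewrite hw leqnn.
have [ta [tah taP]] := @extract_subsequence
  (fun k j => bnorm (vA T (sg j) wbar - vs) < k.+1%:R^-1)
  (fun k N => hvs _ N (i0 k)).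
pose nk := sg \o ta.
have nkh : {homo nk : k l / (k < l)%N >-> (k < l)%N}.
  by move=> k l kl; apply/sgh/tah.
exists nk, vs; split=> // [k||a].
- by case: (sgP (ta k)).
- apply: (squeeze_cvgr _ (cvg_cst _) (@cvg_harmonic R)).
  by apply: nearW => k; rewrite sqrtr_ge0; exact: ltW (taP k).
have c1 : (fun k => Num.sqrt (sqsum (nk k) * (nk k)%:R)) @ \oo --> (0 : R).
  rewrite -[X in _ --> X](@sqrtr0 R).
  apply: (@continuous_cvg _ _ _ _ _ _ Num.sqrt); first exact: sqrt_continuous.
  apply: (squeeze_cvgr _ (cvg_cst _) (@cvg_harmonic R)).
  apply: nearW => k; rewrite mulr_ge0 ?sqsum_ge0//=.
  have [_ h] := sgP (ta k); apply: (le_trans h).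
  (* The second extraction only improves the first bound, because [ta k] is at least [k]. *)
  rewrite lef_pV2 ?posrE ?ltr0n// ler_nat ltnS; exact: homo_geq_id tah k.
have c2 : (fun k => Num.sqrt (sqsum (nk k))) @ \oo --> (0 : R).
  exact: (cvg_comp nk _ (cvg_homo nkh) sqrt_sqsum_cvg).
have c3 : (fun k => wbar%:R * (`|A| * Num.sqrt (sqsum (nk k) * (nk k)%:R)
    + `|B| * Num.sqrt (sqsum (nk k)))) @ \oo --> (0 : R).
  rewrite -[X in _ --> X](mulr0 wbar%:R); apply: cvgMr.
  rewrite -[X in _ --> X](addr0 (0 : R)); apply: cvgD.
    by rewrite -(mulr0 `|A|); apply: cvgMr.
  by rewrite -(mulr0 `|B|); apply: cvgMr.
apply: norm_cvg0; apply: (squeeze_cvgr _ (cvg_cst _) c3).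
apply: nearW => k; rewrite normr_ge0/=.
have [n1 _] := sgP (ta k); exact: pinner_le (hAB _ n1).
Qed.

(** * Optimality of the limit and convergence of the whole sequence *)

Section Limit.
Variables (nk : nat -> nat) (vs : X) (l : R).
Hypotheses (nk1 : forall k, (1 <= nk k)%N)
  (nkh : {homo nk : k l / (k < l)%N >-> (k < l)%N})
  (hvs : (fun k => bnorm (vA T (nk k) wbar - vs)) @ \oo --> (0 : R))
  (hpin : forall a, (fun k => pinner wbar T a (nk k)) @ \oo --> (0 : R))
  (hl : (fun n => Fr n wbar) @ \oo --> l).

Let xstar := xbar P - vs.

Lemma xs_last_cvg a :
  (fun k => bnorm (xs T (nk k) (pl (nk k) a) - xstar)) @ \oo --> (0 : R).
Proof.
have c2 : (fun k => bnorm (vA T (nk k) wbar - vs)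
    + wbar%:R * Num.sqrt (sqsum (nk k))) @ \oo --> (0 : R).
  rewrite -[X in _ --> X](addr0 (0 : R)); apply: cvgD => //.
  rewrite -(mulr0 wbar%:R); apply: cvgMr.
  exact: (cvg_comp nk _ (cvg_homo nkh) sqrt_sqsum_cvg).
apply: (squeeze_cvgr _ (cvg_cst _) c2); apply: nearW => k.
rewrite sqrtr_ge0/= [leRHS]addrC.
have -> : xs T (nk k) (pl (nk k) a) - xstar =
    (vA T (nk k) wbar - vA T (nk k) (pl (nk k) a)) - (vA T (nk k) wbar - vs).
  rewrite /xs /xstar; move: (vA T _ _) (vA T _ _) => u v.
  by apply/ffunP => i; apply/rowP => j; rewrite !ffunE !mxE; ring.
rewrite (le_trans (ip_triangle hbip _ _))// (ip_normN hbip) lerD//.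
exact: drift_le (plast_le _ _).
Qed.

(** The active edge set varies with [k], so no particular edge need be active infinitely often. For
    each edge, being active forces the constraint on the limit once [k] is large. *)
Lemma limit_consensus : Dset xstar.
Proof.
have ev b : \forall k \near \oo, b \in Es T (nk k) -> Hset b xstar.
  have [bH|bH] := pselect (Hset b xstar); first by apply: nearW.
  have [i [j [ib [jb ij]]]] : exists i j, i \in val b.1 /\ j \in val b.1 /\
      xstar i 0 b.2 != xstar j 0 b.2.
    apply: contrapT => h; apply: bH => i j ib jb; apply/eqP/negPn/negP => ij.
    by apply: h; exists i, j.
  pose d := `|xstar i 0 b.2 - xstar j 0 b.2| / 2.
  have d0 : 0 < d by rewrite divr_gt0// normr_gt0 subr_eq0.
  have /cvgr0Pnorm_lt/(_ _ d0) := xs_last_cvg (inr b).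
  apply: filterS => k; rewrite ger0_norm ?sqrtr_ge0// => hd bE.
  have bU : inr b \in updated wbar T (nk k).
    by move: bE; rewrite (hcov (nk1 k)).1 inE.
  have [r /subgradient_edge[xH _ _]] := kkt_last (nk1 k) bU.
  have xij := xH _ _ ib jb.
  have hi := sub_bnorm_le (xs T (nk k) (pl (nk k) (inr b))) xstar i b.2.
  have hj := sub_bnorm_le (xs T (nk k) (pl (nk k) (inr b))) xstar j b.2.
  have : `|xstar i 0 b.2 - xstar j 0 b.2| < d + d.
    rewrite xij in hi.
    rewrite -(subrKA (xs T (nk k) (pl (nk k) (inr b)) j 0 b.2)).
    apply: (le_lt_trans (ler_normD _ _)).
    rewrite distrC; apply: ltrD; first exact: le_lt_trans hi hd.
    exact: le_lt_trans hj hd.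
  by rewrite /d -splitr ltxx.
(* There are finitely many edges, so one [k] works for all; the edges active at this [k] connect the
   vertices. *)
have [k hk] : exists k, forall b, b \in Es T (nk k) -> Hset b xstar.
  exact: filter_ex (filter_forall _ ev).
have [hc _ _ _] := run_edge (nk1 k).
by rewrite -[Dset]hc.
Qed.

Lemma fsum_consensus (x : X) : Dset x ->
  fsum P x = (\sum_i fv P i (x i))%E.
Proof.
move=> xD; rewrite /fsum big_sumType/= [X in (_ + X)%E]big1 ?adde0// => b _.
by rewrite /indicator ifT// inE => i j _ _; rewrite (xD i j).
Qed.

(** Passes to the limit in the formula for the dual value, with each vertex function replaced by an
    arbitrary real number below its value at the limit. *)
Lemma limit_value_ge : ((2^-1 * bnorm vs ^+ 2)%:E + fsum P xstar <= l%:E)%E.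
Proof.
rewrite fsum_consensus; last exact: limit_consensus.
rewrite addeC -leeBrDr// -EFinB; apply: lee_sum_of_lt.
  by move=> i; case: hP => _ _ /(_ i)[[+ _] _ _] _ _; apply.
move=> t ht; rewrite lerBrDr addrC.
have lk : (fun k => Fr (nk k) wbar) @ \oo --> l.
  exact: (cvg_comp nk _ (cvg_homo nkh) hl).
(* A lower bound of the dual value for large [k]: the quadratic term is linearized around [vs], and
   each model value is at least [t i] minus the model error. *)
have rk : (fun k => (2^-1 * bnorm vs ^+ 2
    - bnorm vs * bnorm (vA T (nk k) wbar - vs))
    - \sum_a pinner wbar T a (nk k)
    + (\sum_i t i - \sum_i model_error i (nk k))) @ \oo -->
    (2^-1 * bnorm vs ^+ 2 - bnorm vs * 0) - \sum_(a : idx P) 0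
    + (\sum_i t i - \sum_(i : V) 0).
  apply: cvgD; apply: cvgB.
  - apply: cvgB; first exact: cvg_cst.
    by apply: cvgMr.
  - exact: cvg_sumr.
  - exact: cvg_cst.
  - apply: cvg_sumr => i.
    exact: (cvg_comp nk _ (cvg_homo nkh) (@model_error_cvg i)).
rewrite mulr0 !big1_eq !subr0 in rk.
apply: (ler_cvg_to rk lk).
have ev i : \forall k \near \oo,
    ((t i)%:E < fv P i (xs T (nk k) (pl (nk k) (inl i)) i))%E.
  have lf : lower_semicontinuous (fv P i).
    by case: hP => _ _ /(_ i)[_ + _] _ _.
  have [d d0 hd] := lsc_enorm lf (ht i).
  have /cvgr0Pnorm_lt/(_ _ d0) := xs_last_cvg (inl i).
  apply: filterS => k; rewrite ger0_norm ?sqrtr_ge0// => hk; apply: hd.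
  apply: le_lt_trans hk; have := enorm_le_bnorm (xs T (nk k)
    (pl (nk k) (inl i)) - xstar) i; by rewrite [X in enorm X]ffunE [(- _ : X) i]ffunE.
apply: filterS (filter_forall _ ev) => k hk.
rewrite Fr_wbar_formula//; apply: lerD; first rewrite lerD2r.
  have := ip_half_norm hbip vs (vs - vA T (nk k) wbar).
  by rewrite subKr -(opprB _ vs) (ip_normN hbip).
rewrite -sumrB; apply: ler_sum => i _; rewrite lerBlDr.
by rewrite -lee_fin -fv_last// ltW.
Qed.

Lemma weak_limit (x : X) : (l%:E <= primal P x)%E.
Proof.
have [p hp] : exists p : \bar R, primal P x = p by exists (primal P x).
rewrite hp; case: p hp => [p| |] hp; last 2 first.
- by rewrite leey.
- by have := @weak_duality 1%N wbar x isT (leqnn _); rewrite Fr_wbarE// hp.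
rewrite lee_fin; apply: (cvgr_to_le hl).
exists 1%N => // n /= n1; have := @weak_duality n wbar x n1 (leqnn _).
rewrite Fr_wbarE// hp -EFinD lee_fin; apply: le_trans.
by rewrite lerDl mulr_ge0 ?sqr_ge0 ?invr_ge0.
Qed.

Lemma primal_limitE : primal P xstar = ((2^-1 * bnorm vs ^+ 2)%:E + fsum P xstar)%E.
Proof.
rewrite /primal; congr (_%:E + _)%E; rewrite /xstar addrAC subrr add0r.
by rewrite /bnorm (ip_normN hbip).
Qed.

Lemma primal_limit : primal P xstar = l%:E.
Proof.
apply/eqP; rewrite eq_le weak_limit andbT primal_limitE; exact: limit_value_ge.
Qed.

(** Weak duality bounds half the squared distance by [l - Fr n wbar], for every [n]. As [y] is any
    point of value [l], two such points are limits of the same sequence, which gives uniqueness of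
    the minimizer. *)
Lemma xs_to_minimizer (y : X) : primal P y = l%:E ->
  (fun n => bnorm (xs T n wbar - y)) @ \oo --> (0 : R).
Proof.
move=> hy.
have c : (fun n => Num.sqrt (2 * (l - Fr n wbar))) @ \oo --> (0 : R).
  rewrite -[X in _ --> X](@sqrtr0 R).
  apply: (@continuous_cvg _ _ _ _ _ _ Num.sqrt); first exact: sqrt_continuous.
  rewrite -(mulr0 2); apply: cvgMr; rewrite -(subrr l).
  by apply: cvgB => //; apply: cvg_cst.
apply: (squeeze_cvgr _ (cvg_cst _) c).
exists 1%N => // n /= n1; rewrite sqrtr_ge0/=.
have := @weak_duality n wbar y n1 (leqnn _).
rewrite Fr_wbarE// hy -EFinD lee_fin => h.
rewrite -[leLHS]ger0_norm ?sqrtr_ge0// -sqrtr_sqr ler_wsqrtr//.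
move: h; move: (Fr n wbar) (bnorm _ ^+ 2) => a b h.
by rewrite -ler_pdivrMl// lerBrDl.
Qed.

Lemma minimizer_unique (x : X) : minimizer (primal P) x <-> x = xstar.
Proof.
split=> [hx|->]; last by move=> y; rewrite primal_limit; apply: weak_limit.
have hxl : primal P x = l%:E.
  by apply/eqP; rewrite eq_le weak_limit andbT -primal_limit hx.
have c : (fun n => bnorm (xs T n wbar - x) + bnorm (xs T n wbar - xstar))
    @ \oo --> (0 : R).
  rewrite -[X in _ --> X](addr0 (0 : R)); apply: cvgD; apply: xs_to_minimizer => //.
  exact: primal_limit.
have : bnorm (x - xstar) <= 0.
  apply: (cvgr_to_ge c); apply: nearW => n; rewrite [leRHS]addrC.
  have -> : x - xstar = (xs T n wbar - xstar) - (xs T n wbar - x).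
    by rewrite [- (_ - x)]opprB [RHS]addrC subrKA.
  by rewrite (le_trans (ip_triangle hbip _ _))// (ip_normN hbip).
move=> h; apply/eqP; rewrite -subr_eq0; apply/eqP/(ip_eq0 hbip).
rewrite -(ip_sqr hbip); have -> : Num.sqrt (bdot (x - xstar) (x - xstar)) = 0.
  by apply/eqP; rewrite eq_le h sqrtr_ge0.
by rewrite expr0n.
Qed.

(** Inside iteration [n + 1] the value is squeezed between those at the ends of iterations [n] and
    [n + 1], so the whole sequence converges. *)
Lemma Fapprox_cvg w : (1 <= w <= wbar)%N ->
  (fun n => Fapprox T n w) @ \oo --> l%:E.
Proof.
move=> /andP[w1 wb]; apply/fine_cvgP; split.
  by exists 2%N => // n /= n2; rewrite FrE.
rewrite -(cvg_shiftS (fun n => fine (Fapprox T n w))).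
have hl1 : (fun n => Fr n.+1 wbar) @ \oo --> l.
  by rewrite (cvg_shiftS (fun n => Fr n wbar)).
apply: (squeeze_cvgr _ hl hl1).
exists 1%N => // n /= n1; rewrite FrE//= -Fr_transfer//.
by rewrite !Fr_inner_le// ?wb// leqnn.
Qed.

(** The true dual value lies between the approximate one and the primal value at the limit point,
    both with limit [l]. *)
Lemma Fval_cvg w : (1 <= w <= wbar)%N -> (fun n => Fval T n w) @ \oo --> l%:E.
Proof.
move=> w1b; have hF := Fapprox_cvg w1b.
apply: (squeeze_cvge _ hF (cvg_cst l%:E)).
exists 1%N => // n /= n1; have /andP[_ wb] := w1b.
by rewrite Fapprox_le_Fval//= -primal_limit Fval_le_primal.
Qed.

End Limit.

End Run.

Theorem theorem3p19 (R : realType) (V : finType) (m : nat)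
  (P : problem R V m) (C1 : R) (wbar : nat) (T : trajectory P)
  (hP : well_posed P) (hC1 : connecting_constant P C1)
  (hw : (0 < wbar)%N) (hrun : run wbar T C1)
  (hfeas : exists x, (primal P x < +oo)%E)
  (hcov : full_coverage wbar T)
  (hA1 : cut_optimality wbar T)
  (hA2 : no_late_edges wbar T)
  (hA3 : starts_with_cuts T) :
  [/\ (\sum_(1 <= n <oo)
         (\sum_(1 <= w < wbar.+1) bnorm (vA T n w - vA T n w.-1) ^+ 2)%:E
       < +oo)%E /\
      (forall n n', (1 <= n <= n')%N ->
         (Fapprox T n wbar <= Fapprox T n' wbar)%E),
      exists C : R, forall n w, (1 <= n)%N -> (1 <= w <= wbar)%N ->
        bnorm (vA T n w) ^+ 2 <= C,
      forall i, (i \in vert3 P) || (i \in vert4 P) ->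
        exists C : R, forall n w, (1 <= n)%N -> (1 <= w <= wbar)%N ->
          bnorm (zs T n w (inl i)) <= C
    & sqrt_growth wbar T ->
      [/\ forall (a : idx P) n, a \notin idx4 P -> (1 <= n)%N ->
            a \in updated wbar T n -> Eerr wbar T a n = 0%E,
          forall i, i \in vert4 P ->
            Eerr wbar T (inl i) n @[n --> \oo] --> 0%E
        & exists (nk : nat -> nat) (vs : {ffun V -> 'rV[R]_m}),
          [/\ (forall k, (1 <= nk k)%N) /\
                {homo nk : k l / (k < l)%N >-> (k < l)%N},
              bnorm (vA T (nk k) wbar - vs) @[k --> \oo] --> (0 : R) /\
                (forall a, pinner wbar T a (nk k) @[k --> \oo] --> (0 : R)),
              forall x, minimizer (primal P) x <-> x = xbar P - vs,
              forall w, (1 <= w <= wbar)%N ->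
                let opt := ((2^-1 * bnorm vs ^+ 2)%:E
                            + fsum P (xbar P - vs)%R)%E in
                Fapprox T (nk k) w @[k --> \oo] --> opt /\
                Fval T (nk k) w @[k --> \oo] --> opt
            & bnorm (xs T n wbar - (xbar P - vs)) @[n --> \oo] --> (0 : R)]]].
Proof.
split.
- split=> [|n n' /[dup] nn' /andP[n1 nn]].
    exact: (summable_increments hP hrun hcov hfeas).
  have n'1 := leq_trans n1 nn; rewrite !(Fr_wbarE hP hrun hcov)// lee_fin.
  exact: (Fr_outer_le hP hrun hcov).
- exact: (vA_bounded hP hrun hcov hfeas).
- exact: (bounded34 hP hrun hcov hw hfeas hA3).
move=> hgrowth.
have [nk [vs [nk1 nkh hvs hpin]]] := good_subsequence hP hrun hcov hw hfeas hgrowth.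
have [l hl] := Fr_wbar_cvg hP hrun hcov hfeas.
have hopt : primal P (xbar P - vs) = l%:E.
  by apply: (primal_limit hP hrun hcov hw hfeas hA3 hA2 nk1 nkh hvs hpin hl).
split; first exact: (Eerr_exact hP hrun).
  exact: (Eerr_cvg hP hrun hcov hw hfeas hA3 hA2).
exists nk, vs; split=> //.
- exact: (minimizer_unique hP hrun hcov hw hfeas hA3 hA2 nk1 nkh hvs hpin hl).
- move=> w wb opt; have -> : opt = l%:E by rewrite -hopt primal_limitE.
  have hF := Fval_cvg hP hrun hcov hw hfeas hA3 hA2 nk1 nkh hvs hpin hl wb.
  split; last exact: (cvg_comp nk _ (cvg_homo nkh) hF).
  exact: (cvg_comp nk _ (cvg_homo nkh) (Fapprox_cvg hP hrun hcov hl wb)).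
- exact: (xs_to_minimizer hP hrun hcov hl hopt).
Qed.
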